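(* Let $f \in \mathbb{Z}[t,t^{-1}]$ be a non-zero Laurent polynomial and let $\mu \in \widehat{\mathbb{Z}}^\times$. Assume that $(f(t)) = (f(t^\mu))$ as ideals in $\widehat{\mathbb{Z}}[[\widehat{\mathbb{Z}}]]$. Then either $\mu = \pm 1$, or all roots of $f$ are roots of unity.
   Context: A root of a Laurent polynomial $f$ in a field $K$ is a non-zero $\alpha\in K$ with $f(\alpha)=0$; here roots are taken in an algebraic closure of $\mathbb{Q}$. $\widehat{\mathbb{Z}}$ is the profinite completion of $\mathbb{Z}$, and $\widehat{\mathbb{Z}}[[\widehat{\mathbb{Z}}]] = \varprojlim_{m,n} (\mathbb{Z}/m)[\mathbb{Z}/n]$ is the completed group ring of the (additive) profinite group $\widehat{\mathbb{Z}}$ with coefficients in $\widehat{\mathbb{Z}}$. The group ring $\mathbb{Z}[\mathbb{Z}] \simeq \mathbb{Z}[t,t^{-1}]$ embeds in it, with $t$ corresponding to the group element $1\in\mathbb{Z}\subset\widehat{\mathbb{Z}}$; for $\nu\in\widehat{\mathbb{Z}}$, $t^\nu$ denotes the group element $\nu\in\widehat{\mathbb{Z}}$. For $f=\sum_k a_k t^k$, $f(t^\mu) = \sum_k a_k t^{k\mu}$. For an element $x$, $(x)$ denotes the principal ideal of $\widehat{\mathbb{Z}}[[\widehat{\mathbb{Z}}]]$ generated by $x$ (automatically closed, by compactness; called a continuous ideal). *)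

(* Defs.v *)
From HB Require Import structures.
From mathcomp Require Import all_boot all_order all_algebra all_field.
From mathcomp Require Import boolp classical_sets.
From mathcomp Require Import finmap.
From mathcomp.multinomials Require Import monalg.

Set Implicit Arguments.
Unset Strict Implicit.
Unset Printing Implicit Defensive.

Import Order.TTheory GRing.Theory Num.Theory.
Local Open Scope ring_scope.

(* A proper alias: {ffun G -> R} itself carries the pointwise product. *)
Definition group_alg (R : comNzRingType) (G : finZmodType) : Type :=
  {ffun G -> R}.

Section GroupAlg.
Variables (R : comNzRingType) (G : finZmodType).
Local Notation A := (group_alg R G).
Implicit Types x y z : A.

HB.instance Definition _ := GRing.Zmodule.on A.

Definition galg_fun x : G -> R := fun g => (x : {ffun G -> R}) g.

Lemma galgP x y : galg_fun x =1 galg_fun y -> x = y.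
Proof. by move=> xy; apply/ffunP. Qed.

Definition galg_delta (g : G) : A := [ffun h => (h == g)%:R].

Definition galg_mul x y : A :=
  [ffun g => \sum_(h : G) galg_fun x h * galg_fun y (g - h)].

Lemma galg_mulE x y g :
  galg_fun (galg_mul x y) g = \sum_(h : G) galg_fun x h * galg_fun y (g - h).
Proof. by rewrite /galg_fun /galg_mul ffunE. Qed.

Lemma galg_deltaE g h : galg_fun (galg_delta g) h = (h == g)%:R.
Proof. by rewrite /galg_fun /galg_delta ffunE. Qed.

Lemma galgD x y g : galg_fun (x + y) g = galg_fun x g + galg_fun y g.
Proof. by rewrite /galg_fun ffunE. Qed.

Lemma galgB x y g : galg_fun (x - y) g = galg_fun x g - galg_fun y g.
Proof. by rewrite /galg_fun !ffunE. Qed.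

Lemma galg_mulC : commutative galg_mul.
Proof.
move=> x y; apply: galgP => g; rewrite !galg_mulE.
rewrite (reindex_inj (inv_inj (subKr g))).
by apply: eq_bigr => h _; rewrite subKr mulrC.
Qed.

Lemma galg_mulA : associative galg_mul.
Proof.
move=> x y z; apply: galgP => g; rewrite !galg_mulE.
under eq_bigr do rewrite galg_mulE mulr_sumr.
under [RHS]eq_bigr do rewrite galg_mulE mulr_suml.
rewrite [RHS]exchange_big /=; apply: eq_bigr => h _.
rewrite [RHS](reindex_inj (addIr h)); apply: eq_bigr => k _.
by rewrite mulrA addrK opprD (addrC (- k)) addrA.
Qed.

Lemma galg_mul1 : left_id (galg_delta 0) galg_mul.
Proof.
move=> x; apply: galgP => g; rewrite galg_mulE (bigD1 0) //=.
rewrite galg_deltaE eqxx mul1r subr0 big1 ?addr0 // => h /negPf h0.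
by rewrite galg_deltaE h0 mul0r.
Qed.

Lemma galg_mulDl : left_distributive galg_mul +%R.
Proof.
move=> x y z; apply: galgP => g.
rewrite galgD !galg_mulE -big_split; apply: eq_bigr => h _.
by rewrite galgD mulrDl.
Qed.

Lemma galg_1_neq0 : galg_delta 0 != 0 :> A.
Proof.
apply/eqP => /(congr1 (galg_fun^~ 0)); rewrite galg_deltaE eqxx => /eqP.
by rewrite /galg_fun ffunE oner_eq0.
Qed.

HB.instance Definition _ := GRing.Zmodule_isComNzRing.Build A
  galg_mulA galg_mulC galg_mul1 galg_mulDl galg_1_neq0.

End GroupAlg.

Section GroupAlgMap.
Variables (R S : comNzRingType) (G H : finZmodType).
Variables (psi : R -> S) (phi : G -> H).

(* The map R[G] -> S[H] sending \sum_g a_g g to \sum_g psi(a_g) phi(g). *)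
Definition galg_map (x : group_alg R G) : group_alg S H :=
  [ffun h => \sum_(g : G | phi g == h) psi (galg_fun x g)].

Lemma galg_mapE x h :
  galg_fun (galg_map x) h = \sum_(g : G | phi g == h) psi (galg_fun x g).
Proof. by rewrite /galg_fun /galg_map ffunE. Qed.

Hypothesis psiB : {morph psi : a b / a - b}.
Hypothesis psi1 : psi 1 = 1.
Hypothesis psiM : {morph psi : a b / a * b}.
Hypothesis phiB : {morph phi : a b / a - b}.

Let psi0 : psi 0 = 0. Proof. by rewrite -(subrr 0) psiB subrr. Qed.
Let psiD : {morph psi : a b / a + b}.
Proof.
move=> a b; have psiN c : psi (- c) = - psi c by rewrite -sub0r psiB psi0 sub0r.
by rewrite -{1}(opprK b) psiB psiN opprK.
Qed.

Lemma galg_map_sub : {morph galg_map : x y / x - y}.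
Proof.
move=> x y; apply: galgP => h; rewrite galgB !galg_mapE -sumrB.
by apply: eq_bigr => g _; rewrite galgB psiB.
Qed.

Lemma galg_map_delta g : galg_map (galg_delta R g) = galg_delta S (phi g).
Proof.
apply: galgP => h; rewrite galg_mapE galg_deltaE [h == _]eq_sym.
have E k : psi (galg_fun (galg_delta R g) k) = (k == g)%:R.
  by rewrite galg_deltaE; case: (k == g).
under eq_bigr do rewrite E.
case: eqP => [<-|/eqP ne].
  rewrite (bigD1 g) //= eqxx big1 ?addr0 // => k /andP[_ /negPf ->] //.
by rewrite big1 // => k /eqP kh; case: eqP => // kg; rewrite -kh kg eqxx in ne.
Qed.

Lemma galg_map_one : galg_map 1 = 1.
Proof. by rewrite [LHS]galg_map_delta -(subrr 0) phiB subrr. Qed.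

Lemma galg_map_mul : {morph galg_map : x y / x * y}.
Proof.
move=> x y; apply: galgP => h; rewrite [RHS]galg_mulE galg_mapE.
transitivity (\sum_(a : G) \sum_(b : G | phi b == h - phi a)
                psi (galg_fun x a) * psi (galg_fun y b)).
  under eq_bigr => g _.
    rewrite [galg_fun _ g]galg_mulE.
    rewrite (big_morph psi psiD psi0).
    under eq_bigr do rewrite psiM.
    over.
  rewrite exchange_big /=; apply: eq_bigr => a _.
  rewrite (reindex_inj (addIr a)) /=; apply: eq_big => b; last by rewrite addrK.
  by rewrite -[X in _ = (phi X == _)](addrK a) phiB (inj_eq (addIr _)).
under [RHS]eq_bigr do rewrite !galg_mapE mulr_suml.
rewrite [RHS](exchange_big_dep xpredT) //=; apply: eq_bigr => a _.
rewrite [RHS](big_pred1 (phi a)) => [|k]; last by rewrite eq_sym.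
by rewrite mulr_sumr.
Qed.

End GroupAlgMap.

(* The transition functions are total for convenience; only those with
   [below i j] are constrained and used. *)
Record inv_sys := InvSys {
  idx : Type;
  idx0 : idx;
  below : rel idx;
  obj : idx -> comNzRingType;
  tr : forall i j : idx, obj j -> obj i;
  tr_sub : forall i j, below i j -> {morph @tr i j : x y / x - y};
  tr_one : forall i j, below i j -> @tr i j 1 = 1;
  tr_mul : forall i j, below i j -> {morph @tr i j : x y / x * y}
}.
Arguments tr : clear implicits.

Record invlim (S : inv_sys) := InvLim {
  proj :> forall i : idx S, obj i;
  projP : forall i j, below i j -> tr S i j (proj j) = proj i
}.

Section InvLim.
Variable S : inv_sys.
Implicit Types x y z : invlim S.

HB.instance Definition _ := gen_eqMixin (invlim S).
HB.instance Definition _ := gen_choiceMixin (invlim S).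

Lemma invlim_ext x y : (forall i, x i = y i) -> x = y.
Proof.
case: x y => [x xP] [y yP] /= xy.
have E : x = y by apply: functional_extensionality_dep.
by subst y; congr InvLim; apply: Prop_irrelevance.
Qed.

Fact tr0 i j : below i j -> tr S i j 0 = 0.
Proof. by move=> ij; rewrite -(subrr 0) tr_sub // subrr. Qed.
Fact trN i j : below i j -> {morph tr S i j : x / - x}.
Proof. by move=> ij x; rewrite -sub0r tr_sub // tr0 // sub0r. Qed.
Fact trD i j : below i j -> {morph tr S i j : x y / x + y}.
Proof. by move=> ij x y; rewrite -{1}(opprK y) tr_sub // trN // opprK. Qed.

Definition invlim_zero : invlim S :=
  @InvLim S (fun=> 0) (fun i j ij => tr0 ij).
Definition invlim_one : invlim S :=
  @InvLim S (fun=> 1) (fun i j ij => tr_one ij).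
Program Definition invlim_opp x : invlim S := @InvLim S (fun i => - x i) _.
Next Obligation. by rewrite trN // projP. Qed.
Program Definition invlim_add x y : invlim S :=
  @InvLim S (fun i => x i + y i) _.
Next Obligation. by rewrite trD // !projP. Qed.
Program Definition invlim_mul x y : invlim S :=
  @InvLim S (fun i => x i * y i) _.
Next Obligation. by rewrite tr_mul // !projP. Qed.

Fact invlim_addA : associative invlim_add.
Proof. by move=> x y z; apply: invlim_ext => i; apply: addrA. Qed.
Fact invlim_addC : commutative invlim_add.
Proof. by move=> x y; apply: invlim_ext => i; apply: addrC. Qed.
Fact invlim_add0 : left_id invlim_zero invlim_add.
Proof. by move=> x; apply: invlim_ext => i; apply: add0r. Qed.
Fact invlim_addN : left_inverse invlim_zero invlim_opp invlim_add.
Proof. by move=> x; apply: invlim_ext => i; apply: addNr. Qed.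

HB.instance Definition _ := GRing.isZmodule.Build (invlim S)
  invlim_addA invlim_addC invlim_add0 invlim_addN.

Fact invlim_mulA : associative invlim_mul.
Proof. by move=> x y z; apply: invlim_ext => i; apply: mulrA. Qed.
Fact invlim_mulC : commutative invlim_mul.
Proof. by move=> x y; apply: invlim_ext => i; apply: mulrC. Qed.
Fact invlim_mul1 : left_id invlim_one invlim_mul.
Proof. by move=> x; apply: invlim_ext => i; apply: mul1r. Qed.
Fact invlim_mulDl : left_distributive invlim_mul +%R.
Proof. by move=> x y z; apply: invlim_ext => i; apply: mulrDl. Qed.
Fact invlim_1_neq0 : invlim_one != 0.
Proof.
apply/eqP => /(congr1 (fun x : invlim S => x (idx0 S))) /eqP.
by rewrite /= oner_eq0.
Qed.

HB.instance Definition _ := GRing.Zmodule_isComNzRing.Build (invlim S)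
  invlim_mulA invlim_mulC invlim_mul1 invlim_mulDl invlim_1_neq0.

Definition invlim_unit : pred (invlim S) :=
  fun x => `[< exists y, y * x = 1 >].
Definition invlim_inv x : invlim S :=
  if pselect (exists y, y * x == 1) is left ex then xchoose ex else x.

Fact invlim_mulV : {in invlim_unit, left_inverse 1 invlim_inv *%R}.
Proof.
move=> x /asboolP[y yx]; rewrite /invlim_inv; case: pselect => [ex|[]].
  by apply/eqP; apply: (xchooseP ex).
by exists y; apply/eqP.
Qed.
Fact invlim_unitP x y : y * x = 1 -> invlim_unit x.
Proof. by move=> yx; apply/asboolP; exists y. Qed.
Fact invlim_inv_out : {in [predC invlim_unit], invlim_inv =1 id}.
Proof.
move=> x /= xU; rewrite /invlim_inv; case: pselect => // -[y yx].
by case/negP: xU; apply/asboolP; exists y; apply/eqP.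
Qed.

HB.instance Definition _ := GRing.ComNzRing_hasMulInverse.Build (invlim S)
  invlim_mulV invlim_unitP invlim_inv_out.

End InvLim.

(* Index n stands for the modulus n + 2: Z/1 is not a [comNzRingType], and
   dropping the modulus 1 does not change the limit, as the moduli >= 2 are
   cofinal for divisibility. *)
Definition mod_below (m n : nat) : bool := (m.+2 %| n.+2)%N.

Definition Zmod_tr (m n : nat) (x : 'Z_n.+2) : 'Z_m.+2 := inZp x.

Section ZmodTr.
Variables m n : nat.
Hypothesis mn : mod_below m n.

Lemma Zmod_tr_nat (k : nat) : Zmod_tr m (inZp k : 'Z_n.+2) = inZp k.
Proof. by apply: val_inj => /=; rewrite modn_dvdm. Qed.

Lemma Zmod_tr_add : {morph @Zmod_tr m n : x y / x + y}.
Proof.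
by move=> x y; apply: val_inj => /=; rewrite modn_dvdm // modnDm.
Qed.

Lemma Zmod_tr_sub : {morph @Zmod_tr m n : x y / x - y}.
Proof.
by move=> x y; apply: (addIr (Zmod_tr m y)); rewrite -Zmod_tr_add !subrK.
Qed.

Lemma Zmod_tr_one : Zmod_tr m (1 : 'Z_n.+2) = 1.
Proof. exact: (Zmod_tr_nat 1). Qed.

Lemma Zmod_tr_mul : {morph @Zmod_tr m n : x y / x * y}.
Proof.
by move=> x y; apply: val_inj => /=; rewrite modn_dvdm // modnMm.
Qed.

End ZmodTr.

Definition Zhat_sys : inv_sys :=
  @InvSys nat 0%N mod_below (fun n => 'Z_n.+2) Zmod_tr
    Zmod_tr_sub Zmod_tr_one Zmod_tr_mul.

Definition Zhat : Type := invlim Zhat_sys.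
HB.instance Definition _ := GRing.ComUnitRing.on Zhat.

Definition mod2_below (i j : nat * nat) : bool :=
  mod_below i.1 j.1 && mod_below i.2 j.2.

Definition Zgalg (i : nat * nat) : comNzRingType :=
  group_alg 'Z_i.1.+2 'Z_i.2.+2.

Definition Zgalg_tr (i j : nat * nat) : Zgalg j -> Zgalg i :=
  galg_map (@Zmod_tr i.1 j.1) (@Zmod_tr i.2 j.2).

Fact Zgalg_tr_sub i j :
  mod2_below i j -> {morph @Zgalg_tr i j : x y / x - y}.
Proof.
by case/andP => ij1 ij2; apply: galg_map_sub; exact: Zmod_tr_sub.
Qed.

Fact Zgalg_tr_one i j : mod2_below i j -> @Zgalg_tr i j 1 = 1.
Proof.
case/andP => ij1 ij2; apply: galg_map_one; first exact: Zmod_tr_sub.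
- exact: Zmod_tr_one.
- exact: Zmod_tr_sub.
Qed.

Fact Zgalg_tr_mul i j :
  mod2_below i j -> {morph @Zgalg_tr i j : x y / x * y}.
Proof.
case/andP => ij1 ij2; apply: galg_map_mul.
- exact: Zmod_tr_sub.
- exact: Zmod_tr_mul.
- exact: Zmod_tr_sub.
Qed.

(* \varprojlim_(m, n) (Z/m)[Z/n], with both moduli shifted by 2 as for Zhat. *)
Definition ZZhat_sys : inv_sys :=
  @InvSys (nat * nat)%type (0%N, 0%N) mod2_below Zgalg Zgalg_tr
    Zgalg_tr_sub Zgalg_tr_one Zgalg_tr_mul.

Definition ZZhat : Type := invlim ZZhat_sys.
HB.instance Definition _ := GRing.ComUnitRing.on ZZhat.

Definition tpow_fam (nu : Zhat) (i : nat * nat) : Zgalg i :=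
  galg_delta 'Z_i.1.+2 (nu i.2 : 'Z_i.2.+2).

Fact tpow_subproof (nu : Zhat) i j :
  mod2_below i j -> Zgalg_tr i (tpow_fam nu j) = tpow_fam nu i.
Proof.
case/andP => ij1 ij2; rewrite /Zgalg_tr /tpow_fam galg_map_delta.
- by congr galg_delta; apply: (projP nu ij2).
- exact: Zmod_tr_sub.
- exact: Zmod_tr_one.
Qed.

(* The group element t^nu. *)
Definition tpow (nu : Zhat) : ZZhat :=
  @InvLim ZZhat_sys (tpow_fam nu) (@tpow_subproof nu).

Definition principal_ideal (R : comNzRingType) (x : R) : set R :=
  [set y * x | y in [set: R]]%classic.

(* The elements of Z[Z] = Z[t, t^-1]: finitely supported families of integer
   coefficients f@_k indexed by k : int, with support msupp f. *)
Definition laurent : Type := {malg int[int]}.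
HB.instance Definition _ := GRing.Zmodule.on laurent.

(* f(t^mu); in particular f(t) is the case mu = 1. *)
Definition laurent_tpow (f : laurent) (mu : Zhat) : ZZhat :=
  \sum_(k <- msupp f) tpow (mu *~ k) *~ f@_k.

Definition laurent_horner (f : laurent) (a : algC) : algC :=
  \sum_(k <- msupp f) (f@_k)%:~R * a ^ k.

Definition laurent_root (f : laurent) (a : algC) : Prop :=
  a != 0 /\ laurent_horner f a = 0.

(* Main.v *)
(* Let [al] be a root of [f] that is not a root of unity, [g] its primitive
   minimal polynomial, and suppose that [mu] is neither 1 nor -1, so that [mu] is
   not rational.  Fix [T] and let [n] run through the multiples of a modulus
   depending on [T].  If the natural number [m] represents [mu] modulo [n], the
   equality of ideals implies that [x^n - 1] divides [f(x^m)] for every root [x]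
   of [g], away from the primes dividing a fixed integer [c].  By Dirichlet's
   box principle [a m = b] modulo [n] for some [0 < a <= T] and [|b| <= n / T];
   raising [x^m - y] to [a]-th powers, [x^n - 1] divides the product of the
   [x^b - y^a] over the roots [y] of [f].  None of these factors vanishes: for
   each [a] at most one [b] satisfies [x^b = y^a], and the modulus rules it out
   because [a mu <> b].  Multiplying over all [x], the prime-to-[c] part of the
   resultant of [g] and [X^n - 1] divides a nonzero integer of size at most
   [exp(C (T + n / T))], where [C] does not depend on [T].  By Kronecker's
   theorem the Mahler measure of [g] exceeds 1, so that for suitable [n] this
   part of the resultant grows like [exp(C' n)], a contradiction if [T] is
   large. *)
Require Import Defs.
From HB Require Import structures.
From mathcomp Require Import all_boot all_order all_algebra all_field.
From mathcomp Require Import boolp classical_sets.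
From mathcomp Require Import finmap.
From mathcomp.multinomials Require Import monalg.
From mathcomp Require Import zify ring.

Set Implicit Arguments.
Unset Strict Implicit.
Unset Printing Implicit Defensive.

Import Order.TTheory GRing.Theory Num.Theory.
Local Open Scope ring_scope.

Local Notation pZtoC := (map_poly (intr : int -> algC)).

(** * Algebraic integers and Galois invariance *)

Local Notation pQtoC := (map_poly (ratr : rat -> algC)).

(** The splitting field of the minimal polynomial of [x] is Galois over the rationals, and each of
    its automorphisms extends to [algC], so [x] lies in the fixed field. *)
Lemma aut_fixed_Crat (x : algC) :
  (forall nu : {rmorphism algC -> algC}, nu x = x) -> x \in Crat.
Proof.
move=> fix_x.
have [p [Dp mon_p] min_p] := minCpolyP x.
have [rs Drs] := closed_field_poly_normal (minCpoly x).
rewrite (monicP (minCpoly_monic x)) scale1r in Drs.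
have [Qs [QsC [s1 Ds1 gen1]]] := num_field_exists rs.
have Dp1 : map_poly (in_alg Qs) p = \prod_(y <- s1) ('X - y%:P).
  apply: (map_poly_inj QsC); rewrite -map_poly_comp map_prod_XsubC.
  transitivity (minCpoly x); last first.
    by rewrite Drs -Ds1 big_map.
  by rewrite Dp; apply: eq_map_poly => a; rewrite /= alg_num_field fmorph_rat.
(* As [p] is irreducible, it divides [e] or [d]. If [p %| e], the gcd [d] is constant by degree;
   [p %| d] would make [p] divide its nonzero derivative. *)
have sep_p : separable_poly p.
  rewrite unlock; set d := gcdp p p^`().
  have [e De] := dvdpP _ _ (dvdp_gcdl p p^`() : d %| p).
  have /orP[pe | pd] : (p %| e) || (p %| d).
    by rewrite -!min_p -rootM -rmorphM -De min_p.
    have : e * d != 0 by rewrite -De monic_neq0.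
    rewrite mulf_eq0 negb_or => /andP[e0 d0].
    have := dvdp_leq e0 pe; rewrite {1}De size_mul // => le_ed.
    rewrite coprimep_def -/d.
    have : (0 < size d)%N by rewrite size_poly_gt0.
    have : (0 < size e)%N by rewrite size_poly_gt0.
    by move: le_ed; move: (size _) (size _) => m n; lia.
  have : p %| p^`() := dvdp_trans pd (dvdp_gcdr _ _).
  have sp : (1 < size p)%N.
    by rewrite -(size_map_poly (ratr : rat -> algC)) -Dp size_minCpoly.
  have p0 : p^`() != 0.
    apply/eqP => /(congr1 (fun q : {poly rat} => q`_(size p).-2)).
    rewrite coef_deriv coef0; move: sp (monicP mon_p : p`_(size p).-1 = 1).
    by case: (size p) => [|[|k]] //= _ -> /eqP; rewrite pnatr_eq0.
  by move/(dvdp_leq p0); rewrite leqNgt lt_size_deriv ?monic_neq0.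
have split_p : splittingFieldFor 1 (map_poly (in_alg Qs) p) {:Qs}.
  by exists s1; [rewrite Dp1 eqpxx | exact: gen1].
have Qs_ax : FieldExt_isSplittingField _ Qs.
  constructor; exists (map_poly (in_alg Qs) p) => //.
  by apply/polyOverP => i; rewrite coef_map /= rpredZ // rpred1.
pose Qn : splittingFieldType rat := HB.pack_for (splittingFieldType rat) Qs Qs_ax.
have galQ : galois 1 {:Qn}.
  apply/splitting_galoisField; exists (map_poly (in_alg Qs) p); split => //.
    by apply/polyOverP => i; rewrite coef_map /= rpredZ // rpred1.
  by rewrite separable_map.
have : root (pQtoC p) x by rewrite min_p.
rewrite -Dp Drs root_prod_XsubC -Ds1 => /mapP[y _ Dx].
have : y \in fixedField 'Gal({:Qn} / 1)%g.
  apply/fixedFieldP; first exact: memvf.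
  move=> s _; have [nu Dnu] := extend_algC_subfield_aut (Qs := Qn) QsC s.
  by apply: (fmorph_inj QsC); rewrite Dnu -Dx fix_x.
have/galois_fixedField-> := galQ.
by case/vlineP=> a Dy; rewrite Dx Dy alg_num_field fmorph_rat Crat_rat.
Qed.

(** The factorization records the roots with their multiplicities. *)
Definition roots_of (g : {poly int}) (rs : seq algC) : Prop :=
  pZtoC g = (lead_coef g)%:~R *: \prod_(z <- rs) ('X - z%:P).

Lemma roots_of_exists (g : {poly int}) : {rs : seq algC | roots_of g rs}.
Proof.
have [rs Drs] := closed_field_poly_normal (pZtoC g); exists rs.
by rewrite /roots_of {1}Drs lead_coef_map_inj //; apply: intr_inj.
Qed.

Lemma root_roots_of g rs x : g != 0 -> roots_of g rs ->
  root (pZtoC g) x = (x \in rs).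
Proof.
move=> g0 ->; rewrite rootZ ?root_prod_XsubC //.
by rewrite intr_eq0 lead_coef_eq0.
Qed.

Lemma perm_map_aut (nu : {rmorphism algC -> algC}) g rs :
  g != 0 -> roots_of g rs -> perm_eq (map nu rs) rs.
Proof.
move=> g0 Dg; have lg : (lead_coef g)%:~R != 0 :> algC.
  by rewrite intr_eq0 lead_coef_eq0.
apply: prod_XsubC_eq; apply: (scalerI lg); rewrite -Dg big_map.
rewrite -map_prod_XsubC -(rmorph_int nu) -map_polyZ -Dg -map_poly_comp.
by apply: eq_map_poly => k; rewrite /= rmorph_int.
Qed.

(** Automorphisms of [algC] permute the roots of an integer polynomial, so all of them fix the
    double product. *)
Lemma Crat_prod_roots (g1 g2 : {poly int}) rs1 rs2 (F : algC -> algC -> algC) :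
  g1 != 0 -> g2 != 0 -> roots_of g1 rs1 -> roots_of g2 rs2 ->
  (forall (nu : {rmorphism algC -> algC}) x y, nu (F x y) = F (nu x) (nu y)) ->
  \prod_(x <- rs1) \prod_(y <- rs2) F x y \in Crat.
Proof.
move=> g10 g20 D1 D2 nuF; apply: aut_fixed_Crat => nu.
rewrite rmorph_prod -[RHS](perm_big _ (perm_map_aut nu g10 D1)) big_map.
apply: eq_bigr => x _; rewrite rmorph_prod.
rewrite -[RHS](perm_big _ (perm_map_aut nu g20 D2)) big_map.
by apply: eq_bigr => y _; rewrite nuF.
Qed.

Lemma Aint_lead_root (g : {poly int}) x :
  root (pZtoC g) x -> (lead_coef g)%:~R * x \in Aint.
Proof.
have [->|g0] := eqVneq g 0; first by rewrite lead_coef0 mul0r Aint0.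
have [sg1|sg] := leqP (size g) 1.
  rewrite (size1_polyC sg1) map_polyC rootC lead_coefC /= => /eqP->.
  by rewrite mul0r Aint0.
move=> gx; set l := lead_coef g.
(* With [d] the degree of [g], this is [l^(d-1) g(X / l)], monic with root [l * x]. *)
pose q : {poly int} := \poly_(i < size g)
  (if i == (size g).-1 then 1 else g`_i * l ^+ ((size g).-2 - i)).
have sq : size q = size g by rewrite size_poly_eq // eqxx oner_eq0.
have mq : q \is monic.
  by rewrite monicE lead_coefE sq coef_poly eqxx ltn_predL size_poly_gt0 g0.
apply: (@root_monic_Aint (pZtoC q)); last 2 first.
- by rewrite monic_map.
- by apply/polyOverP => i; rewrite coef_map /= intr_int.
apply/rootP; rewrite horner_coef size_map_inj_poly ?rmorph0 //; last exact: intr_inj.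
have gE : (pZtoC g).[x] = 0 by apply/rootP.
rewrite horner_coef size_map_inj_poly ?rmorph0 // in gE; last exact: intr_inj.
rewrite sq -[RHS](mulr0 (l%:~R ^+ (size g).-2)) -[X in _ = _ * X]gE mulr_sumr {gE}.
apply: eq_bigr => i _; rewrite !coef_map coef_poly ltn_ord.
have Ei := ltn_ord i; case: eqP => [Di | /eqP Di].
  have Dl : g`_i = l by rewrite Di.
  rewrite /= Dl mul1r exprMn mulrA -exprSr; congr (_ ^+ _ * _).
  by apply: (etrans Di); move: (size g) sg => [|[]].
have {}Ei : (i <= (size g).-2)%N by move: (size g) (nat_of_ord i) Ei Di => m k; lia.
rewrite /= rmorphM rmorphXn /= exprMn -mulrA [X in _ * X = _]mulrA -exprD subnK //.
by rewrite mulrCA.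
Qed.

(** For [c > 0], the ring of algebraic integers with [c] inverted; divisibility in it ignores the
    primes dividing [c]. *)
Definition Sint (c : nat) : {pred algC} :=
  fun x => `[< exists J, c%:R ^+ J * x \in Aint >].

Lemma SintP c x : reflect (exists J, c%:R ^+ J * x \in Aint) (x \in Sint c).
Proof. exact: asboolP. Qed.

Fact Sint_subring_closed c : subring_closed (Sint c).
Proof.
have cA J : c%:R ^+ J \in Aint by rewrite rpredX // rpred_nat.
split.
- by apply/SintP; exists 0%N; rewrite expr0 mul1r Aint1.
- move=> x y /SintP[J xJ] /SintP[K yK]; apply/SintP; exists (J + K)%N.
  rewrite mulrBr rpredB // exprD; last by rewrite -mulrA rpredM.
  by rewrite mulrAC rpredM.
- move=> x y /SintP[J xJ] /SintP[K yK]; apply/SintP; exists (J + K)%N.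
  by rewrite exprD mulrACA rpredM.
Qed.
HB.instance Definition _ c :=
  GRing.isSubringClosed.Build algC (Sint c) (Sint_subring_closed c).

Lemma Sint_scale c x : c%:R * x \in Aint -> x \in Sint c.
Proof. by move=> cx; apply/SintP; exists 1%N; rewrite expr1. Qed.

Lemma Sint_Crat c x : x \in Sint c -> x \in Crat ->
  exists J (z : int), c%:R ^+ J * x = z%:~R.
Proof.
move=> /SintP[J xJ] xQ; exists J; apply/intrP.
by rewrite Cint_rat_Aint // rpredM // rpredX // rpred_nat.
Qed.

(** * Resultants as determinants of polynomials in a matrix *)

Lemma horner_char_poly (R : comNzRingType) n (A : 'M[R]_n) z :
  (char_poly A).[z] = \det (z%:M - A).
Proof.
rewrite -[LHS]/(horner_eval z _) -det_map_mx; congr (\det _).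
apply/matrixP => i j; rewrite /char_poly_mx !mxE.
by rewrite rmorphB rmorphMn /= /horner_eval hornerX hornerC.
Qed.

Lemma det_horner_prod (R : comNzRingType) n (A : 'M[R]_n.+1) (rs : seq R) :
  \det (horner_mx A (\prod_(z <- rs) ('X - z%:P)))
  = \prod_(z <- rs) ((-1) ^+ n.+1 * (char_poly A).[z]).
Proof.
rewrite rmorph_prod (big_morph _ (@det_mulmx R n.+1) (det1 _ _)).
apply: eq_bigr => z _; rewrite horner_char_poly -detZ scaleN1r opprB.
by rewrite rmorphB /= horner_mx_X horner_mx_C.
Qed.

(** The determinant is the resultant of [char_poly A] and [g]: visibly an integer, and computable
    from the roots of [g]. *)
Lemma det_horner_roots n (A : 'M[int]_n.+1) g rs : roots_of g rs ->
  (\det (horner_mx A g))%:~R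
  = (lead_coef g)%:~R ^+ n.+1
    * \prod_(z <- rs) ((-1) ^+ n.+1 * (pZtoC (char_poly A)).[z]) :> algC.
Proof.
move=> Dg; rewrite -det_map_mx map_horner_mx Dg horner_mxZ detZ.
by rewrite det_horner_prod map_char_poly.
Qed.

Lemma exists_char_poly (R : comNzRingType) n (h : {poly R}) :
  h \is monic -> size h = n.+2 -> exists A : 'M[R]_n.+1, char_poly A = h.
Proof.
move=> mon_h sh; have := companionmxK mon_h; move: (companionmx h).
by rewrite sh /= => A; exists A.
Qed.

Lemma intr_Fp_eq0 p (z : int) : prime p -> (z%:~R == 0 :> 'F_p) = (p %| z)%Z.
Proof.
move=> pp; by rewrite (dvdz_pcharf (pchar_Fp pp)).
Qed.

(** Evaluating a Bezout relation modulo [p] at [A] kills the multiple of [char_poly A] by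
    Cayley-Hamilton, so [g(A)] is invertible modulo [p]. *)
Lemma det_coprime_mod p n (A : 'M[int]_n.+1) (g : {poly int}) : prime p ->
  coprimep (map_poly (intr : int -> 'F_p) g) (map_poly intr (char_poly A)) ->
  ~~ (p %| \det (horner_mx A g))%Z.
Proof.
move=> pp cop; rewrite -intr_Fp_eq0 // -det_map_mx map_horner_mx.
move: cop; rewrite map_char_poly => /Bezout_coprimepP[[u v] /=] /eqpf_eq[k k0].
move/(congr1 (horner_mx (map_mx intr A))).
rewrite rmorphD !rmorphM /= Cayley_Hamilton mulr0 addr0 alg_polyC horner_mx_C.
move=> /(congr1 (fun B => \det B)); rewrite det_mulmx det_scalar => E.
apply: contraNneq k0 => D0; move/eqP: E; rewrite D0 mulr0 eq_sym.
by rewrite expf_eq0.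
Qed.

(** * Resultants prime to a given integer *)

Lemma pigeonhole (T : finType) (u : nat -> T) :
  exists i j, (i < j <= #|T|)%N /\ u i = u j.
Proof.
have : ~~ injectiveb (fun i : 'I_#|T|.+1 => u i).
  by apply/injectiveP => /leq_card; rewrite card_ord ltnn.
case/injectivePn => i [j ij uij].
have : (i != j :> nat) by [].
rewrite neq_ltn => /orP[lt_ij | lt_ji].
  by exists i, j; rewrite lt_ij -ltnS ltn_ord.
by exists j, i; rewrite lt_ji -ltnS ltn_ord.
Qed.

(** There are finitely many remainders modulo [g], so two powers of ['X] share theirs. *)
Lemma dvdp_Xn_period (F : finFieldType) (g : {poly F}) : g != 0 ->
  exists e N, (0 < N)%N /\ g %| 'X^e * ('X^N - 1).
Proof.
move=> g0.
have [i [j [/andP[ij _] Dij]]] :=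
  pigeonhole (fun i => poly_rV ('X^i %% g) : 'rV[F]_(size g)).
exists i, (j - i)%N; rewrite subn_gt0; split=> //.
have sz k : (size ('X^k %% g)%R <= size g)%N by rewrite ltnW // ltn_modp.
have {}Dij : 'X^i %% g = 'X^j %% g.
  by rewrite -(poly_rV_K (sz i)) Dij poly_rV_K.
rewrite mulrBr mulr1 -exprD subnKC ?(ltnW ij) //.
by rewrite /dvdp modpD modpN Dij subrr.
Qed.

(** The quotient of ['X^(N * k) - 1] by ['X^N - 1], whose resultant with [g] can be kept prime to
    [c]. *)
Definition geom (R : nzRingType) (N k : nat) : {poly R} :=
  \sum_(j < k) 'X^N ^+ j.

Lemma geomE (R : comNzRingType) N k :
  'X^(N * k) - 1 = ('X^N - 1) * geom R N k.
Proof. by rewrite exprM subrX1. Qed.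

Lemma monic_geom (R : comNzRingType) N k :
  (0 < N)%N -> (0 < k)%N -> geom R N k \is monic.
Proof.
move=> N0 k0; have mX n : (0 < n)%N -> 'X^n - 1 \is @monic R.
  by move=> n0; apply: monicXnsubC.
by rewrite -(monicMl _ (mX N N0)) -geomE mX // muln_gt0 N0.
Qed.

Lemma size_geom (R : comNzRingType) N k :
  (0 < N)%N -> (0 < k)%N -> size (geom R N k) = (N * k.-1).+1.
Proof.
move=> N0 k0; have := congr1 (fun p : {poly R} => size p) (geomE R N k).
rewrite mulrC size_monicM ?monic_geom ?monicXnsubC //.
  rewrite !size_XnsubC ?muln_gt0 ?N0 //.
  case: k k0 => // k _ /=; rewrite mulnS addnS /= => /eqP; rewrite -addnS addnC.
  by rewrite eqn_add2r eq_sym => /eqP.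
by rewrite -size_poly_gt0 size_XnsubC.
Qed.

Lemma map_geom (R S : nzRingType) (phi : {rmorphism R -> S}) N k :
  map_poly phi (geom R N k) = geom S N k.
Proof.
rewrite rmorph_sum; apply: eq_bigr => j _.
by rewrite !rmorphXn /= map_polyX.
Qed.

Lemma coprimep_congr_const (F : fieldType) (a h : {poly F}) c :
  c != 0 -> a %| h - c%:P -> coprimep a h.
Proof.
move=> c0 ah; apply/coprimepP => d da dh.
rewrite -size_poly_eq1 -dvdp1 -(eqp_dvdr _ (_ : c%:P %= 1)) ?polyC_eqp1 //.
by rewrite -(dvdp_subr _ dh) (dvdp_trans da).
Qed.

Lemma coprimep_geom (F : fieldType) (g : {poly F}) e N k : (0 < N)%N ->
  g %| 'X^e * ('X^N - 1) -> k%:R != 0 :> F -> coprimep g (geom F N k).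
Proof.
move=> N0 gdv k0; apply: coprimep_dvdr gdv _.
rewrite coprimepMl; apply/andP; split.
  apply: coprimep_expl; apply: (@coprimep_congr_const _ _ _ 1) => //.
    exact: oner_neq0.
  case: k k0 => [|k _]; first by rewrite eqxx.
  rewrite /geom big_ord_recl expr0 addrC addrA addNr add0r.
  apply: (big_ind (fun p => 'X %| p)); [exact: dvdp0 | exact: dvdp_add |].
  move=> i _; rewrite -exprM.
  by rewrite dvdp_exp // muln_gt0 N0.
apply: coprimep_congr_const k0 _.
have -> : k%:R%:P = \sum_(j < k) 1 :> {poly F}.
  by rewrite sumr_const card_ord rmorph_nat.
rewrite /geom -sumrB.
apply: (big_ind (fun p => _ %| p)); [exact: dvdp0 | exact: dvdp_add |].
by move=> i _; rewrite [X in _ %| X]subrX1 dvdp_mulr.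
Qed.

Lemma common_modulus (T : eqType) (s : seq T) (P : T -> nat -> Prop) :
  (forall x, x \in s -> exists N, (0 < N)%N /\ forall n, (N %| n)%N -> P x n) ->
  exists N, (0 < N)%N /\ forall x n, x \in s -> (N %| n)%N -> P x n.
Proof.
elim: s => [|x s IHs] sP; first by exists 1%N.
have [|N [N0 NP]] := IHs; first by move=> y ys; apply: sP; rewrite inE ys orbT.
have [M [M0 MP]] := sP x (mem_head x s).
exists (M * N)%N; rewrite muln_gt0 M0; split=> // y n.
rewrite inE => /predU1P[-> | ys] MNn; first by apply/MP/(dvdn_trans _ MNn)/dvdn_mulr.
by apply: NP => //; apply/(dvdn_trans _ MNn)/dvdn_mull.
Qed.

Lemma coprime_primeP (m n : nat) : (0 < n)%N ->
  (forall p, prime p -> (p %| n)%N -> ~~ (p %| m)%N) -> coprime m n.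
Proof.
move=> n0 cop; apply: contraT; rewrite /coprime => g1.
have pg : prime (pdiv (gcdn m n)).
  by apply: pdiv_prime; rewrite ltn_neqAle eq_sym g1 gcdn_gt0 n0 orbT.
have /negP[] := cop _ pg (dvdn_trans (pdiv_dvd _) (dvdn_gcdr _ _)).
exact: dvdn_trans (pdiv_dvd _) (dvdn_gcdl _ _).
Qed.

(* At a prime dividing [c], a power of ['X] times ['X^N - 1] vanishes modulo [g],
   so [geom N k] reduces to the unit [k] modulo each factor of [g] other than
   ['X], while its constant term is 1. *)
Lemma geom_resultant (g : {poly int}) rs (c : nat) : (0 < c)%N ->
  roots_of g rs ->
  (forall p, prime p -> map_poly (intr : int -> 'F_p) g != 0) ->
  exists N1, (0 < N1)%N /\ forall N k, (N1 %| N)%N -> (0 < N)%N -> (1 < k)%N ->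
    coprime k c -> exists (E : int) s, coprime `|E| c /\
    E%:~R = (-1) ^+ s * (lead_coef g)%:~R ^+ (N * k.-1)
            * \prod_(z <- rs) (geom algC N k).[z].
Proof.
move=> c0 Dg g_prim.
(* One [N1] serves all primes dividing [c]; only the exponent [e] varies with the prime. *)
have [p pc | N1 [N10 N1P]] := @common_modulus nat (primes c)
    (fun p n => exists e, map_poly (intr : int -> 'F_p) g %| 'X^e * ('X^n - 1)).
  move: pc; rewrite mem_primes => /and3P[pp _ _].
  have [e [N [N0 gN]]] := dvdp_Xn_period (g_prim p pp).
  exists N; split=> // n /dvdnP[q ->]; exists e.
  apply: dvdp_trans gN _; apply: dvdp_mul => //.
  by rewrite (mulnC q N) geomE dvdp_mulr.
exists N1; split=> // N k N1N N0 k1 kc; have k0 := ltnW k1.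
have [||A DA] := @exists_char_poly int (N * k.-1).-1 (geom int N k).
- exact: monic_geom.
- by rewrite size_geom // prednK // muln_gt0 N0 -ltnS prednK.
have sE : (N * k.-1).-1.+1 = (N * k.-1)%N.
  by rewrite prednK // muln_gt0 N0 -ltnS prednK.
exists (\det (horner_mx A g)), (N * k.-1 * size rs)%N; split.
  apply: (coprime_primeP c0) => p pp pc.
  rewrite -[(p %| _)%N]/((p %| _)%Z); apply: det_coprime_mod => //.
  have /N1P/(_ N1N)[e gN] : p \in primes c by rewrite mem_primes pp c0.
  rewrite DA map_geom; apply: coprimep_geom N0 gN _.
  rewrite -(dvdn_pcharf (pchar_Fp pp)) -prime_coprime // coprime_sym.
  exact: coprime_dvdr pc kc.
rewrite (det_horner_roots A Dg) DA map_geom sE big_split /=.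
by rewrite big_const_seq count_predT iter_mulr_1 -exprM mulrCA mulrA.
Qed.

(** * Lower bounds for the values of X^n - 1 *)

Definition nontorsion (x : algC) : Prop := forall n, (0 < n)%N -> x ^+ n != 1.

(** The factor contributed by the root [x] to the Mahler measure. *)
Definition max1 (x : algC) : algC := if `|x| <= 1 then 1 else `|x|.

Lemma max1_ge1 x : 1 <= max1 x.
Proof.
rewrite /max1; case: ifP => // /negbT; rewrite -real_ltNge ?normr_real ?real1 //.
exact: ltW.
Qed.

Lemma norm_le_max1 x : `|x| <= max1 x.
Proof. by rewrite /max1; case: ifP. Qed.

Lemma pos_lower_bound (T : eqType) (s : seq T) (F : T -> algC) :
  (forall x, x \in s -> 0 < F x) ->
  exists delta, 0 < delta /\ forall x, x \in s -> delta <= F x.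
Proof.
elim: s => [|x s IHs] Fpos; first by exists 1.
have [y ys|d [d0 dP]] := IHs; first by apply: Fpos; rewrite inE ys orbT.
have Fx := Fpos x (mem_head _ _).
have [le_dx | lt_xd] := real_leP (gtr0_real d0) (gtr0_real Fx).
  by exists d; split=> // y; rewrite inE => /predU1P[-> | /dP].
exists (F x); split=> // y; rewrite inE => /predU1P[-> // | /dP].
exact/le_trans/ltW.
Qed.

Lemma nontorsion_inv x : nontorsion x -> nontorsion x^-1.
Proof. by move=> ntx n n0; rewrite exprVn invr_eq1 ntx. Qed.

(* If both values were small, so would be [x ^+ (n' - n) - 1]. *)
Lemma not_both_near_one_disc x (s : seq nat) :
  nontorsion x -> `|x| <= 1 -> all (leq 1) s ->
  exists delta, 0 < delta /\ forall n n', (n < n')%N -> (n' - n)%N \in s ->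
    (delta <= `|x ^+ n - 1|) || (delta <= `|x ^+ n' - 1|).
Proof.
move=> ntx x1 s0.
have [l ls|d [d0 dP]] := @pos_lower_bound _ s (fun l => `|x ^+ l - 1|).
  by rewrite normr_gt0 subr_eq0 ntx // (allP s0).
exists (d / 2); split=> [|n n' nn' /dP]; first by rewrite divr_gt0.
apply: contraTT; rewrite negb_or.
rewrite -!real_ltNge ?rpredM ?normr_real ?gtr0_real ?invr_gt0 ?ltr0n //.
case/andP=> Hn Hn'.
have -> : x ^+ (n' - n) - 1 = (x ^+ n' - 1) - x ^+ (n' - n) * (x ^+ n - 1).
  by rewrite mulrBr -exprD subnK 1?ltnW // mulr1; ring.
apply: le_lt_trans (ler_normB _ _) _; rewrite [d]splitr; apply: ltrD => //.
apply: le_lt_trans Hn; rewrite normrM normrX ler_piMl //.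
by rewrite exprn_ile1.
Qed.

(** Outside the unit disc one passes to [x^-1], and the factor [|x|^k] gained in [|x^k - 1|] is the
    power of [max1 x]. *)
Lemma not_both_near_one x (s : seq nat) :
  nontorsion x -> all (leq 1) s ->
  exists delta, 0 < delta /\ forall n n', (n < n')%N -> (n' - n)%N \in s ->
    (delta * max1 x ^+ n <= `|x ^+ n - 1|)
    || (delta * max1 x ^+ n' <= `|x ^+ n' - 1|).
Proof.
move=> ntx s0; rewrite /max1; case: ifPn => x1.
  have [d [d0 dP]] := not_both_near_one_disc ntx x1 s0.
  by exists d; split=> // n n'; rewrite !expr1n !mulr1; apply: dP.
rewrite -real_ltNge ?normr_real ?real1 // in x1.
have x0 : 0 < `|x| := lt_trans ltr01 x1.
have xu : x != 0 by rewrite -normr_gt0.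
have [|d [d0 dP]] := not_both_near_one_disc (nontorsion_inv ntx) _ s0.
  by rewrite normfV invf_le1 // ltW.
exists d; split=> // n n' nn' /(dP _ _ nn').
have E k : `|x ^+ k - 1| = `|x^-1 ^+ k - 1| * `|x| ^+ k.
  by rewrite -normrX -normrM mulrBl mul1r -exprMn mulVf // expr1n distrC.
by rewrite !E !ler_pM2r ?exprn_gt0.
Qed.

(* Each [x] is bad for at most one element of [J]. *)
Lemma common_good (X : eqType) (P : X -> nat -> bool) (s : seq X) (J : seq nat) :
  uniq J -> (size s < size J)%N ->
  (forall x i j, x \in s -> i \in J -> j \in J -> (i < j)%N -> P x i || P x j) ->
  exists j, j \in J /\ forall x, x \in s -> P x j.
Proof.
elim: s J => [|x s IHs] J uJ.
  by case: J uJ => // j J _ _ _; exists j; rewrite mem_head.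
move=> sJ good; case: (boolP (all (P x) J)) => [/allP allP_x | /allPn[j0 j0J bad]].
  have [||j [jJ jP]] := IHs J uJ; first exact: ltnW.
    by move=> y i j ys; apply: good; rewrite inE ys orbT.
  by exists j; split=> // y; rewrite inE => /predU1P[-> | /jP]; first exact: allP_x.
have [|||j [jJ jP]] := IHs (rem j0 J); first exact: rem_uniq.
- by rewrite size_rem // -ltnS (ltn_predK sJ).
- move=> y i j ys /mem_rem iJ /mem_rem jJ; apply: good => //.
  by rewrite inE ys orbT.
move: jJ; rewrite mem_rem_uniq // inE => /andP[jj0 jJ].
exists j; split=> // y; rewrite inE => /predU1P[-> | /jP //].
have : (j != j0 :> nat) by [].
rewrite neq_ltn => /orP[/(good x) | /(good x)] /(_ (mem_head _ _)).
  by move=> /(_ jJ j0J); rewrite (negPf bad) orbF.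
by move=> /(_ j0J jJ); rewrite (negPf bad).
Qed.

Lemma not_both_near_one_seq (s : seq algC) (D : seq nat) :
  all (leq 1) D -> (forall x, x \in s -> nontorsion x) ->
  exists delta, 0 < delta /\ forall x, x \in s ->
    forall n n', (n < n')%N -> (n' - n)%N \in D ->
    (delta * max1 x ^+ n <= `|x ^+ n - 1|)
    || (delta * max1 x ^+ n' <= `|x ^+ n' - 1|).
Proof.
move=> D0; elim: s => [|x s IHs] nts; first by exists 1.
have [y ys|d1 [d10 d1P]] := IHs; first by apply: nts; rewrite inE ys orbT.
have [d2 [d20 d2P]] := not_both_near_one (nts x (mem_head _ _)) D0.
have [d [d0 [le1 le2]]] : exists d, 0 < d /\ d <= d1 /\ d <= d2.
  have [le12 | lt21] := real_leP (gtr0_real d10) (gtr0_real d20).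
    by exists d1.
  by exists d2; rewrite d20 (ltW lt21).
have wk y n e : d <= e -> e * max1 y ^+ n <= `|y ^+ n - 1| ->
    d * max1 y ^+ n <= `|y ^+ n - 1|.
  move=> de; apply: le_trans; rewrite ler_wpM2r // exprn_ge0 //.
  exact: le_trans ler01 (max1_ge1 y).
exists d; split=> // y; rewrite inE => /predU1P[-> | ys] n n' nn' nD.
  have := d2P n n' nn' nD.
  by case/orP=> [/(wk _ _ _ le2) -> | /(wk _ _ _ le2) ->]; rewrite ?orbT.
have := d1P y ys n n' nn' nD.
by case/orP=> [/(wk _ _ _ le1) -> | /(wk _ _ _ le1) ->]; rewrite ?orbT.
Qed.

(** Among [size s + 1] consecutive values of [j], any two exponents differ by some [B * l] with
    [1 <= l <= size s], so each [x] spoils at most one value. The bound [delta] is fixed before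
    [m]. *)
Lemma window (s : seq algC) (A B : nat) :
  (0 < B)%N -> (forall x, x \in s -> nontorsion x) ->
  exists delta, 0 < delta /\ forall m, exists j, (m <= j)%N /\
    forall x, x \in s ->
      delta * max1 x ^+ (A + B * j) <= `|x ^+ (A + B * j) - 1|.
Proof.
move=> B0 nts.
pose diffs := [seq (B * l)%N | l <- iota 1 (size s)].
have d0 : all (leq 1) diffs.
  by apply/allP => x /mapP[l]; rewrite mem_iota => /andP[l0 _] ->; rewrite muln_gt0 B0.
have [delta [delta0 dP]] := not_both_near_one_seq d0 nts.
exists delta; split=> // m.
have [|||j [jJ jP]] := @common_good _
  (fun x j => delta * max1 x ^+ (A + B * j) <= `|x ^+ (A + B * j) - 1|)
  s (iota m (size s).+1); first exact: iota_uniq.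
- by rewrite size_iota.
- move=> x i j xs; rewrite !mem_iota => /andP[mi _] /andP[_ jm] ij; apply: dP => //.
    by rewrite ltn_add2l ltn_pmul2l.
  rewrite subnDl -mulnBr; apply: map_f; rewrite mem_iota.
  by move: (size s) jm mi ij => k; lia.
by exists j; split=> //; move: jJ; rewrite mem_iota => /andP[].
Qed.

(** * Returns to 1 on the unit circle and Kronecker's theorem *)

Lemma norm_prod_seq (s : seq algC) (F : algC -> algC) :
  `|\prod_(x <- s) F x| = \prod_(x <- s) `|F x|.
Proof. exact: (big_morph _ (@normrM _) (normr1 _)). Qed.

Lemma ler_prod_seq (T : eqType) (s : seq T) (F G : T -> algC) :
  (forall x, x \in s -> 0 <= F x <= G x) ->
  0 <= \prod_(x <- s) F x <= \prod_(x <- s) G x.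
Proof.
elim: s => [|x s IHs] FG; first by rewrite !big_nil ler01 lexx.
rewrite !big_cons; have /andP[F0 le] := FG x (mem_head _ _).
have /andP[PF Ple] := IHs (fun y ys => FG y (@mem_behead _ (x :: s) y ys)).
by rewrite mulr_ge0 //= ler_pM.
Qed.

Lemma truncn_close (a b : algC) : 0 <= a -> 0 <= b ->
  Num.truncn a = Num.truncn b -> `|a - b| <= 1.
Proof.
move=> a0 b0 eq_ab; have := truncn_itv a0; have := truncn_itv b0.
rewrite eq_ab => /andP[b1 b2] /andP[a1 a2].
rewrite real_ler_norml ?rpredB ?ger0_real //; apply/andP; split.
  rewrite lerBrDr addrC lerBlDr; apply: le_trans (ltW b2) _.
  by rewrite -natr1 lerD2r.
rewrite lerBlDr; apply: le_trans (ltW a2) _.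
by rewrite -natr1 addrC lerD2l.
Qed.

Lemma circle_return (x : algC) (K : nat) : `|x| = 1 ->
  exists n, (0 < n)%N /\ K%:R * `|x ^+ n - 1| <= 2.
Proof.
move=> x1; have xk k : `|x ^+ k| = 1 by rewrite normrX x1 expr1n.
(* For real [y] in [[-1, 1]] this lies in [[0, 2K]], so its integer part takes at most [2 * K + 1]
   values. *)
pose bnd (y : algC) := K%:R * (y + 1).
have bound y k : y = 'Re (x ^+ k) \/ y = 'Im (x ^+ k) ->
    0 <= bnd y /\ (Num.truncn (bnd y) < (2 * K).+1)%N.
  move=> Dy; have yR : y \is Num.real by case: Dy => ->; rewrite ?Creal_Re ?Creal_Im.
  have : `|y| <= 1.
    rewrite -(@expr_le1 _ 2%N) // real_normK // -(expr1n _ 2) -(xk k) normC2_Re_Im.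
    by case: Dy => ->; rewrite ?lerDl ?lerDr real_exprn_even_ge0 ?Creal_Re ?Creal_Im.
  rewrite real_ler_norml // => /andP[y1 y2].
  have b0 : 0 <= bnd y by rewrite mulr_ge0 ?ler0n // -lerBlDr sub0r.
  split=> //; rewrite ltnS -(ler_nat algC).
  have /andP[le _] := truncn_itv b0; apply: le_trans le _.
  by rewrite natrM [leRHS]mulrC ler_wpM2l ?ler0n // -[2]/(1 + 1) lerD2r.
pose u k : 'I_(2 * K).+1 * 'I_(2 * K).+1 :=
  (inord (Num.truncn (bnd ('Re (x ^+ k)))), inord (Num.truncn (bnd ('Im (x ^+ k))))).
have [i [j [/andP[ij _] [Eu1 Eu2]]]] := pigeonhole u.
exists (j - i)%N; rewrite subn_gt0; split=> //.
have -> : `|x ^+ (j - i) - 1| = `|x ^+ i - x ^+ j|.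
  rewrite -[LHS]mul1r -{1}(xk i) -normrM mulrBr mulr1 -exprD subnKC ?(ltnW ij) //.
  exact: distrC.
have close (y z : algC) : 0 <= bnd y /\ (Num.truncn (bnd y) < (2 * K).+1)%N ->
    0 <= bnd z /\ (Num.truncn (bnd z) < (2 * K).+1)%N ->
    inord (Num.truncn (bnd y)) = inord (Num.truncn (bnd z)) :> 'I_(2 * K).+1 ->
    K%:R * `|y - z| <= 1.
  move=> [y0 yK] [z0 zK] /(congr1 (fun i : 'I__ => i : nat)); rewrite !inordK //.
  move=> /(truncn_close y0 z0); rewrite /bnd -mulrBr normrM normr_nat.
  by rewrite opprD addrACA subrr addr0.
have cR := close _ _ (bound _ i (or_introl erefl)) (bound _ j (or_introl erefl)) Eu1.
have cI := close _ _ (bound _ i (or_intror erefl)) (bound _ j (or_intror erefl)) Eu2.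
apply: le_trans (lerD cR cI : _ <= 2); rewrite -mulrDr ler_wpM2l ?ler0n //.
rewrite [x ^+ i in leLHS]Crect [x ^+ j in leLHS]Crect opprD addrACA -mulrBr.
by apply: le_trans (ler_normD _ _) _; rewrite normrM normCi mul1r.
Qed.

(** Bernoulli's inequality reduces this to the archimedean property. *)
Lemma exp_unbounded (M : algC) (A : nat) : 1 < M ->
  exists T, (0 < T)%N /\ A%:R <= M ^+ T.
Proof.
move=> M1; have M0 : 0 < M - 1 by rewrite subr_gt0.
have bern n : 1 + (M - 1) *+ n <= M ^+ n.
  elim: n => [|n IHn]; first by rewrite mulr0n addr0 expr0.
  rewrite exprS; apply: le_trans (_ : M * (1 + (M - 1) *+ n) <= _); last first.
    by rewrite ler_pM2l // (lt_trans ltr01).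
  rewrite -subr_ge0 -(mulr_natr _ n) -(mulr_natr _ n.+1).
  have -> : M * (1 + (M - 1) * n%:R) - (1 + (M - 1) * n.+1%:R) = (M - 1) ^+ 2 * n%:R.
    by rewrite -natr1; ring.
  by rewrite mulr_ge0 ?ler0n // exprn_ge0 // ltW.
have := archi_boundP (divr_ge0 (ler0n algC A) (ltW M0)); move: (Num.bound _) => T.
rewrite ltr_pdivrMr // => AT.
exists T.+1; split=> //; apply: le_trans (bern _).
apply: le_trans (ltW AT) _; rewrite mulr_natl mulrS addrA lerDr.
by rewrite addr_ge0 ?ltW.
Qed.

(* Otherwise the roots lie on the unit circle, and some power [n] of one of them is
   so close to 1 that the nonzero integer [\prod_x (x ^+ n - 1)] has norm < 1. *)
Lemma kronecker (g : {poly int}) rs : g != 0 -> roots_of g rs ->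
  rs != [::] -> 0 \notin rs -> (forall x, x \in rs -> nontorsion x) ->
  1 < `|(lead_coef g)%:~R| * \prod_(x <- rs) max1 x.
Proof.
move=> g0 Dg rs0 rs0' nts; set l : algC := (lead_coef g)%:~R.
have l1 : 1 <= `|l| by rewrite norm_intr_ge1 ?intr_int // intr_eq0 lead_coef_eq0.
have P1 : 1 <= \prod_(x <- rs) max1 x.
  apply: (big_ind (fun y => 1 <= y)) => // [y z|x _]; last exact: max1_ge1.
  exact: mulr_ege1.
rewrite lt_neqAle mulr_ege1 // andbT eq_sym; apply/eqP => E1.
(* Both factors in [E1] are at least 1, so both equal 1; hence every root lies in the closed unit
   disc. *)
have El : `|l| = 1.
  by apply/eqP; rewrite eq_le l1 andbT -[leRHS]E1 ler_peMr ?(le_trans ler01).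
have disc x : x \in rs -> `|x| <= 1.
  move=> xrs; apply: contraTT isT => x1.
  have : max1 x <= 1.
    rewrite -[leRHS]E1 El mul1r (big_rem x) //=.
    rewrite ler_peMr ?(le_trans ler01 (max1_ge1 x)) //.
    apply: (big_ind (fun y => 1 <= y)) => // [y z|y _]; last exact: max1_ge1.
    exact: mulr_ege1.
  by move/(le_trans (norm_le_max1 x)); rewrite (negPf x1).
(* A root is fixed; since the constant term of [g] is a nonzero integer, the product of the [|x|] is
   at least 1, which puts this root on the circle. *)
have [x0 x0rs] : exists x0, x0 \in rs.
  by case: (rs) rs0 => // x0 s _; exists x0; rewrite mem_head.
have prod1 : 1 <= \prod_(x <- rs) `|x|.
  rewrite -norm_prod_seq; have := congr1 (fun p : {poly algC} => p.[0]) Dg.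
  rewrite hornerZ horner_prod -/l => /(congr1 (fun y => `|y|)).
  rewrite normrM El mul1r !norm_prod_seq.
  under eq_bigr do rewrite hornerD hornerX hornerN hornerC sub0r normrN.
  move=> <-; rewrite horner_coef0 coef_map /= norm_intr_ge1 ?intr_int //.
  apply: contra rs0'; rewrite intr_eq0 => /eqP g00.
  by rewrite -(root_roots_of _ g0 Dg) /root horner_coef0 coef_map /= g00.
have x01 : `|x0| = 1.
  apply/eqP; rewrite eq_le disc //=; apply: le_trans prod1 _.
  rewrite (big_rem x0) //= ler_piMr //.
  have /andP[_] : 0 <= \prod_(y <- rem x0 rs) `|y| <= \prod_(y <- rem x0 rs) 1.
    by apply: ler_prod_seq => y /mem_rem /disc ->; rewrite normr_ge0.
  by rewrite [leRHS]big1.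
(* The constant makes [|x0 ^+ n1 - 1|] at most [2^-(d+1)] with [d = size rs], while each other
   factor is at most 2. *)
have [n1 [n10 near1]] := @circle_return x0 (2 ^ (size rs).+2)%N x01.
case: n1 n10 near1 => // n n0 near1.
have [||A DA] := @exists_char_poly int n ('X^(n.+1) - 1).
- exact: monicXnsubC.
- by rewrite size_XnsubC.
have := det_horner_roots A Dg; rewrite DA -/l => /(congr1 (fun y => `|y|)).
rewrite normrM normrX El expr1n mul1r norm_prod_seq.
under eq_bigr do rewrite normrM normrX normrN1 expr1n mul1r rmorphB /=
  map_polyXn rmorph1 hornerD hornerXn hornerN hornerC.
move=> ED.
have D0 : \prod_(z <- rs) `|z ^+ n.+1 - 1| != 0.
  rewrite prodf_seq_neq0; apply/allP => x xrs /=.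
  by rewrite normr_eq0 subr_eq0 nts.
have : 1 <= \prod_(z <- rs) `|z ^+ n.+1 - 1|.
  by rewrite -ED norm_intr_ge1 ?intr_int // -normr_eq0 ED.
apply/negP; rewrite -real_ltNge ?real1 // -?ED ?normr_real // ED.
rewrite (big_rem x0) //=.
have : \prod_(y <- rem x0 rs) `|y ^+ n.+1 - 1| <= 2 ^+ (size rs).
  have /andP[_] : 0 <= \prod_(y <- rem x0 rs) `|y ^+ n.+1 - 1|
                  <= \prod_(y <- rem x0 rs) 2.
    apply: ler_prod_seq => y /mem_rem yrs; rewrite normr_ge0.
    rewrite (le_trans (ler_normB _ _)) // normr1 normrX -[2]/(1 + 1) lerD2r.
    by rewrite exprn_ile1 // disc.
  rewrite big_const_seq count_predT iter_mulr_1 size_rem //.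
  by move/le_trans; apply; rewrite ler_weXn2l ?leq_pred // ler1n.
move=> le2; apply: le_lt_trans (_ : `|x0 ^+ n.+1 - 1| * 2 ^+ size rs < 1).
  by rewrite ler_wpM2l ?normr_ge0.
rewrite -(ltr_pM2l (ltr0n algC 4)) mulr1; apply: le_lt_trans (_ : 2 < 4%:R).
  move: near1; move: `|_ - 1| (size rs) => a d; apply: le_trans.
  rewrite le_eqVlt; apply/orP; left; apply/eqP.
  by rewrite natrX (exprS _ d.+1) (exprS _ d); ring.
by rewrite ltr_nat.
Qed.

(** * Reduction of the completed group ring modulo t^n - 1 *)

(** The projection is named so that it can carry a ring morphism structure. *)
Definition invproj (S : inv_sys) (i : idx S) (x : invlim S) : obj i := x i.

Fact invproj_is_zmod_morphism S i : zmod_morphism (@invproj S i).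
Proof. by []. Qed.
Fact invproj_is_monoid_morphism S i : monoid_morphism (@invproj S i).
Proof. by []. Qed.
HB.instance Definition _ S i :=
  GRing.isZmodMorphism.Build _ _ (@invproj S i) (@invproj_is_zmod_morphism S i).
HB.instance Definition _ S i :=
  GRing.isMonoidMorphism.Build _ _ (@invproj S i) (@invproj_is_monoid_morphism S i).

Lemma Zp_intr_eq0 n (z : int) : (z%:~R == 0 :> 'Z_n.+2) = (n.+2 %| z)%Z.
Proof.
have nat0 k : (k%:R == 0 :> 'Z_n.+2) = (n.+2 %| k)%N.
  by rewrite -val_eqE /= val_Zp_nat.
by case: z => k; rewrite ?NegzE ?rmorphN /= ?oppr_eq0 ?dvdzN; apply: nat0.
Qed.

Lemma Zp_intr_eq n (y z : int) :
  (y%:~R == z%:~R :> 'Z_n.+2) = (n.+2 %| y - z)%Z.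
Proof. by rewrite -subr_eq0 -rmorphB Zp_intr_eq0. Qed.

Section ReductionModulo.
Variables (S : subringClosed algC) (w : algC).

(** Membership of a difference in this set expresses congruence modulo [w] over [S]. *)
Definition wmul : {pred algC} := fun x => `[< exists2 v, v \in S & x = w * v >].

Lemma wmulP x : reflect (exists2 v, v \in S & x = w * v) (x \in wmul).
Proof. exact: asboolP. Qed.

Fact wmul_zmod_closed : zmod_closed wmul.
Proof.
split; first by apply/wmulP; exists 0; rewrite ?rpred0 ?mulr0.
move=> x y /wmulP[u uS ->] /wmulP[v vS ->]; apply/wmulP.
by exists (u - v); rewrite ?rpredB ?mulrBr.
Qed.
HB.instance Definition _ := GRing.isZmodClosed.Build algC wmul wmul_zmod_closed.

Lemma wmulM x y : x \in S -> y \in wmul -> x * y \in wmul.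
Proof.
move=> xS /wmulP[v vS ->]; apply/wmulP; exists (x * v); first exact: rpredM.
by rewrite mulrCA.
Qed.

Lemma wmul_self x : x \in S -> w * x \in wmul.
Proof. by move=> xS; apply/wmulP; exists x. Qed.

End ReductionModulo.

(** * Evaluation of [(Z/m)[Z/n]] at [a], modulo [a ^+ n - 1] *)

Section CyclicEvaluation.
Variables (S : subringClosed algC) (a : algC) (M N : nat).
Hypotheses (a0 : a != 0) (aS : a \in S) (aVS : a^-1 \in S).
Local Notation n := N.+2.
Local Notation m := M.+2.
Local Notation I := (wmul S (a ^+ n - 1)).
Hypothesis mI : m%:R \in I.

Let aXS (k : int) : a ^ k \in S.
Proof. by case: k => k; rewrite ?NegzE -?exprnN -?exprVn rpredX. Qed.

Let expn_val (c : 'Z_n) : (val c)%:R = c.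
Proof. exact: natr_Zp. Qed.

(** A power [b ^+ k - 1] of [b = a ^+ n] is a multiple of [b - 1]; negative exponents reduce to this
    because [b^-1] is in [S]. *)
Lemma expz_congr (y z : int) : (n %| y - z)%Z -> a ^ y - a ^ z \in I.
Proof.
case/dvdzP=> q Dyz; have -> : y = z + n%:Z * q by rewrite mulrC -Dyz; ring.
rewrite expfzDr // -[X in _ - X]mulr1 -mulrBr; apply: wmulM => //.
rewrite -exprz_exp -exprnP; set b := a ^+ n.
have bS : b \in S by rewrite rpredX.
have bVS : b^-1 \in S by rewrite -exprVn rpredX.
have pos k : b ^+ k - 1 \in I.
  by rewrite subrX1; apply: wmul_self; apply: rpred_sum => i _; rewrite rpredX.
case: q {Dyz} => k; first by rewrite -exprnP; apply: pos.
have -> : b ^ Negz k - 1 = - (b^-1 ^+ k.+1 * (b ^+ k.+1 - 1)).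
  rewrite NegzE -exprnN mulrBr mulr1 exprVn mulVf ?opprB //.
  by rewrite !expf_neq0.
by rewrite rpredN; apply: wmulM; rewrite ?rpredX ?pos.
Qed.

Lemma intr_congr (y z : int) : (m %| y - z)%Z -> y%:~R - z%:~R \in I.
Proof.
case/dvdzP=> q Dyz; rewrite -rmorphB /= Dyz rmorphM; apply: wmulM => //.
exact: rpred_int.
Qed.

(** Substitution of [a] for [t] through least residues. It respects the ring operations only modulo
    [I], which contains both [a ^+ n - 1] and [m]. *)
Definition cyc_eval (x : group_alg 'Z_m 'Z_n) : algC :=
  \sum_(g : 'Z_n) (val (galg_fun x g))%:R * a ^+ val g.

(** Two integer lifts of a coefficient differ by a multiple of [m], which lies in [I]; the
    compatibilities below follow by choosing convenient lifts. *)
Lemma cyc_eval_lift x (z : 'Z_n -> int) :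
  (forall g, (z g)%:~R = galg_fun x g) ->
  cyc_eval x - \sum_(g : 'Z_n) (z g)%:~R * a ^+ val g \in I.
Proof.
move=> zx; rewrite -sumrB; apply: rpred_sum => g _; rewrite -mulrBl mulrC.
apply: wmulM; first by rewrite rpredX.
apply: (@intr_congr (Posz (val (galg_fun x g)))); rewrite -Zp_intr_eq zx.
by rewrite -[X in _ == X]natr_Zp.
Qed.

Let lift_val (c : 'Z_m) : (Posz (val c))%:~R = c.
Proof. exact: natr_Zp. Qed.

Lemma cyc_eval_sub x y : cyc_eval (x - y) - (cyc_eval x - cyc_eval y) \in I.
Proof.
have := @cyc_eval_lift (x - y)
  (fun g => Posz (val (galg_fun x g)) - Posz (val (galg_fun y g))).
under eq_bigr do rewrite rmorphB /= mulrBl -!pmulrn.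
rewrite sumrB; apply=> g; by rewrite rmorphB /= !lift_val galgB.
Qed.

Lemma cyc_eval_delta g : cyc_eval (galg_delta _ g) = a ^+ val g.
Proof.
rewrite /cyc_eval (bigD1 g) //= galg_deltaE eqxx mul1r big1 ?addr0 //.
by move=> h /negPf gh; rewrite galg_deltaE gh mul0r.
Qed.

Lemma cyc_eval_mul x y : cyc_eval (x * y) - cyc_eval x * cyc_eval y \in I.
Proof.
pose z g := \sum_(h : 'Z_n)
  Posz (val (galg_fun x h)) * Posz (val (galg_fun y (g - h))).
have zxy g : (z g)%:~R = galg_fun (x * y) g.
  rewrite [RHS]galg_mulE rmorph_sum; apply: eq_bigr => h _.
  by rewrite rmorphM /= !lift_val.
have := cyc_eval_lift zxy; set T := \sum_g _ => cT.
suff TI : T - cyc_eval x * cyc_eval y \in I.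
  by rewrite -[cyc_eval (x * y)](subrK T) -addrA rpredD.
have -> : T = \sum_(h : 'Z_n) \sum_(k : 'Z_n)
    (val (galg_fun x h))%:R * (val (galg_fun y k))%:R * a ^+ val (k + h).
  rewrite /T /z; under eq_bigr do rewrite rmorph_sum mulr_suml.
  rewrite exchange_big; apply: eq_bigr => h _ /=.
  rewrite (reindex_inj (addIr h)); apply: eq_bigr => k _ /=.
  by rewrite rmorphM /= addrK.
rewrite /cyc_eval mulr_suml -sumrB; apply: rpred_sum => h _.
rewrite mulr_sumr -sumrB; apply: rpred_sum => k _.
rewrite mulrACA -mulrBr; apply: wmulM; first by rewrite rpredM ?rpred_nat.
rewrite -exprD; apply: (@expz_congr (Posz (val (k + h))) (Posz (val h + val k))).
by rewrite -Zp_intr_eq -!pmulrn natrD !expn_val addrC.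
Qed.

Lemma cyc_eval_mulz x k : cyc_eval (x *~ k) - cyc_eval x *~ k \in I.
Proof.
have := @cyc_eval_lift (x *~ k) (fun g => Posz (val (galg_fun x g)) * k).
under eq_bigr do rewrite rmorphM /= mulrAC -!pmulrn.
rewrite -mulr_suml mulrzr; apply=> g.
have galgMz (y : group_alg 'Z_m 'Z_n) j : galg_fun (y *~ j) g = galg_fun y g *~ j.
  have galg0 : galg_fun (0 : group_alg 'Z_m 'Z_n) g = 0.
    by have := galgB (0 : group_alg 'Z_m 'Z_n) 0 g; rewrite !subrr.
  have galgMn l : galg_fun (y *+ l) g = galg_fun y g *+ l.
    by elim: l => [|l IHl]; rewrite ?mulr0n // !mulrS galgD IHl.
  case: j => l; first exact: galgMn.
  by rewrite NegzE !mulrNz -[y *~ _]/(y *+ l.+1) -sub0r galgB galg0 galgMn sub0r.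
by rewrite rmorphM /= lift_val galgMz mulrzr.
Qed.

Lemma cyc_eval_sum (T : eqType) (s : seq T) (F : T -> group_alg 'Z_m 'Z_n) :
  cyc_eval (\sum_(i <- s) F i) - \sum_(i <- s) cyc_eval (F i) \in I.
Proof.
elim: s => [|i s IHs]; first by have := cyc_eval_mulz 0 0; rewrite !mulr0z !big_nil.
rewrite !big_cons; set A := \sum_(_ <- s) _ in IHs *; set B := \sum_(_ <- s) _ in IHs *.
(* Additivity comes from compatibility with subtraction, applied to [F i = (F i + A) - A]. *)
have := cyc_eval_sub (F i + A) A; rewrite addrK -rpredN /= => H.
have -> : cyc_eval (F i + A) - (cyc_eval (F i) + B)
  = - (cyc_eval (F i) - (cyc_eval (F i + A) - cyc_eval A)) + (cyc_eval A - B).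
  by ring.
exact: rpredD.
Qed.

Lemma cyc_eval_tpow (mu : Zhat) (k : int) :
  cyc_eval (tpow (mu *~ k) (M, N)) - (a ^+ val (mu N : 'Z_n)) ^ k \in I.
Proof.
rewrite [tpow _ _]/(galg_delta _ _) cyc_eval_delta !exprnP exprz_exp.
apply: expz_congr; rewrite -Zp_intr_eq rmorphM /= -!pmulrn !expn_val mulrzr.
by rewrite -[(mu *~ k) N]/(@invproj Zhat_sys N (mu *~ k)) raddfMz.
Qed.

Lemma cyc_eval_laurent (f : laurent) (mu : Zhat) :
  cyc_eval (laurent_tpow f mu (M, N))
  - laurent_horner f (a ^+ val (mu N : 'Z_n)) \in I.
Proof.
have -> : laurent_tpow f mu (M, N)
    = \sum_(k <- msupp f) (tpow (mu *~ k) (M, N) : group_alg 'Z_m 'Z_n) *~ f@_k.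
  rewrite -[LHS]/(@invproj ZZhat_sys (M, N) _) rmorph_sum.
  by apply: eq_bigr => k _; rewrite raddfMz.
rewrite -(subrKA (\sum_(k <- msupp f)
  cyc_eval ((tpow (mu *~ k) (M, N) : group_alg 'Z_m 'Z_n) *~ f@_k))).
apply: rpredD; first exact: cyc_eval_sum.
rewrite -sumrB; apply: rpred_sum => k _.
rewrite -(subrKA (cyc_eval (tpow (mu *~ k) (M, N)) *~ f@_k)).
apply: rpredD; first exact: cyc_eval_mulz.
by rewrite mulrzl -mulrzBl rpredMz ?cyc_eval_tpow.
Qed.

Lemma cyc_eval_mem x : cyc_eval x \in S.
Proof. by apply: rpred_sum => g _; rewrite rpredM ?rpredX ?rpred_nat. Qed.

(** Write [f(t^mu) = y f(t)] and evaluate at [a]: the right side becomes a multiple of [f(a) = 0]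
    modulo [I]. *)
Lemma laurent_horner_tpow (f : laurent) (mu : Zhat) :
  principal_ideal (laurent_tpow f 1) = principal_ideal (laurent_tpow f mu) ->
  laurent_horner f a = 0 -> laurent_horner f (a ^+ val (mu N : 'Z_n)) \in I.
Proof.
move=> eq_id fa0.
have [y _ Dy] : principal_ideal (laurent_tpow f 1) (laurent_tpow f mu).
  by rewrite eq_id; exists 1 => //; rewrite mul1r.
have mu_I := cyc_eval_laurent f mu; have one_I := cyc_eval_laurent f 1.
have val1 : a ^+ val ((1 : Zhat) N : 'Z_n) = a by rewrite expr1.
rewrite val1 fa0 subr0 in one_I.
have mulI : cyc_eval (laurent_tpow f mu (M, N))
    - cyc_eval (y (M, N)) * cyc_eval (laurent_tpow f 1 (M, N)) \in I.
  by rewrite -Dy; apply: cyc_eval_mul.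
have prodI := wmulM (cyc_eval_mem (y (M, N))) one_I.
have FI := rpredD mulI prodI; rewrite subrK in FI.
by rewrite -[X in X \in _](subKr (cyc_eval (laurent_tpow f mu (M, N)))) rpredB.
Qed.

End CyclicEvaluation.

(** * Rational approximation of mu modulo n *)

(** The index [|z|] stands for the modulus [|z| + 2], which divides [z] only if [z = 0]. *)
Lemma Zhat_intr_eq0 (z : int) : z%:~R = 0 :> Zhat -> z = 0.
Proof.
move=> /(congr1 (@invproj Zhat_sys `|z|%N)); rewrite rmorph_int rmorph0 => /eqP.
rewrite Zp_intr_eq0 => zdv; apply/eqP; rewrite -absz_eq0; apply: contraTT zdv => z0.
by rewrite dvdzE /= gtnNdvd // lt0n.
Qed.

Lemma Zhat_mulrn_inj (x : Zhat) a : (0 < a)%N -> x *+ a = 0 -> x = 0.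
Proof.
move=> a0 xa; apply: invlim_ext => N.
(* Index of the modulus [N.+2 * a]: vanishing of [x *+ a] there gives vanishing of [x] modulo
   [N.+2]. *)
pose K := (N.+2 * a).-2.
have DK : K.+2 = (N.+2 * a)%N by rewrite /K; case: (a) a0 => [|[|b]] //.
have NK : mod_below N K by rewrite /mod_below DK dvdn_mulr.
rewrite -(projP x NK); move: xa => /(congr1 (@invproj Zhat_sys K)).
rewrite raddfMn raddf0 /= /invproj => /eqP; set y : 'Z_K.+2 := x K.
have -> : y *+ a = (Posz (val y * a))%:~R by rewrite -pmulrn natrM natr_Zp mulr_natr.
have key : (K.+2 %| val y * a)%N -> (N.+2 %| val y)%N.
  by move: (val y) => v; rewrite DK dvdn_pmul2r.
rewrite Zp_intr_eq0 dvdzE /= => /key Ny.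
by apply: val_inj => /=; rewrite (eqP Ny).
Qed.

(** Reducing [a mu = b] modulo [a] gives [a | b], and reducing [a = mu^-1 b] modulo [b] gives
    [b | a]; so [b] is [a] or [-a], and [a] cancels by torsion-freeness. *)
Lemma Zhat_unit_rational (mu : Zhat) a (b : int) : mu \is a GRing.unit ->
  (0 < a)%N -> mu *+ a = b%:~R -> mu = 1 \/ mu = -1.
Proof.
move=> mu_unit a0 Dab.
have Da : (Posz a)%:~R = mu^-1 *~ b :> Zhat.
  by rewrite -[RHS]mulrzr -Dab -[mu *+ a]mulr_natr mulrA mulVr // mul1r pmulrn.
have b0 : b != 0.
  apply: contraTneq a0 => b0; move: Da; rewrite b0 mulr0z => /Zhat_intr_eq0 [->].
  by [].
have ab : (a %| `|b|)%N.
  (* The case [a = 1] is split off because the moduli of [Zhat] start at 2. *)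
  case: a a0 Dab {Da} => [|[|a]] // _.
  move/(congr1 (@invproj Zhat_sys a)); rewrite rmorph_int raddfMn /=.
  rewrite -mulr_natr pchar_Zp // mulr0 => /esym/eqP.
  by rewrite Zp_intr_eq0.
have ba : (`|b| %| a)%N.
  case Eb : `|b|%N (b0) => [|[|B]] b0'; rewrite ?dvd1n //.
    by move/eqP: Eb; rewrite absz_eq0 (negPf b0).
  move/(congr1 (@invproj Zhat_sys B)): Da; rewrite rmorph_int raddfMz /=.
  have -> : invproj (S := Zhat_sys) B mu^-1 *~ b = 0.
    rewrite -mulrzr; have /eqP-> : b%:~R == 0 :> 'Z_B.+2.
      by rewrite Zp_intr_eq0 dvdzE Eb.
    by rewrite mulr0.
  by move/eqP; rewrite Zp_intr_eq0.
have {ab ba} Eab : a = `|b|%N by apply/eqP; rewrite eqn_dvd ab.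
have [b_ge0 | b_lt0] := lerP 0 b.
  left; apply/eqP; rewrite -subr_eq0; apply/eqP/(Zhat_mulrn_inj a0).
  rewrite mulrnBl Dab; have -> : b = Posz a by rewrite Eab gez0_abs.
  by rewrite -pmulrn subrr.
right; apply/eqP; rewrite -addr_eq0; apply/eqP/(Zhat_mulrn_inj a0).
rewrite mulrnDl Dab; have -> : b = - Posz a by rewrite Eab ltz0_abs ?opprK.
by rewrite mulrNz -pmulrn addNr.
Qed.

(** As [a mu - b] is nonzero, some modulus detects it, and then so does every multiple of that
    modulus. *)
Lemma Zhat_irrational_modulus (mu : Zhat) a (b : int) : mu \is a GRing.unit ->
  mu <> 1 -> mu <> -1 -> (0 < a)%N ->
  exists N0, (0 < N0)%N /\ forall N, (N0 %| N.+2)%N ->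
    ~~ (N.+2 %| Posz (val (mu N : 'Z_N.+2) * a) - b)%Z.
Proof.
move=> mu_unit mu1 muN1 a0; pose X : Zhat := mu *+ a - b%:~R.
have [i Xi] : exists i, X i <> 0.
  apply: contrapT => /forallNP X0.
  have : X = 0 by apply: invlim_ext => i; apply: contrapT (X0 i).
  move/eqP; rewrite subr_eq0 => /eqP /(Zhat_unit_rational mu_unit a0).
  by case.
exists i.+2; split=> // N iN; apply/negP => Ndv; apply: Xi.
rewrite -(projP X (iN : @below Zhat_sys i N)).
suff -> : X N = 0 by apply: tr0.
rewrite -[X N]/(@invproj Zhat_sys N X) rmorphB rmorph_int raddfMn /=.
apply/eqP; rewrite subr_eq0 /invproj; set y : 'Z_N.+2 := mu N.
have -> : y *+ a = (Posz (val y * a))%:~R by rewrite -pmulrn natrM natr_Zp mulr_natr.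
by rewrite Zp_intr_eq.
Qed.

Lemma nontorsion_expz_inj x : x != 0 -> nontorsion x ->
  injective (fun b : int => x ^ b).
Proof.
move=> x0 ntx b1 b2 /= E; apply/eqP; rewrite -subr_eq0; set b := b1 - b2.
have xb : x ^ b = 1 by rewrite expfzDr // E -expfzDr // subrr.
rewrite -absz_eq0; apply: contraT; rewrite -lt0n => /ntx /eqP[].
move: xb; case: (b) => k //=; rewrite NegzE -exprnN => /eqP.
by rewrite invr_eq1 => /eqP.
Qed.

(* At most one [b] satisfies [x ^ b = y ^+ a]; as [mu] is not rational, a modulus
   separates it from [mu * a]. *)
Lemma avoid_relation (mu : Zhat) (x y : algC) a : mu \is a GRing.unit ->
  mu <> 1 -> mu <> -1 -> x != 0 -> nontorsion x -> (0 < a)%N ->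
  exists N0, (0 < N0)%N /\ forall N, (N0 %| N.+2)%N -> forall b : int,
    (N.+2 %| Posz (val (mu N : 'Z_N.+2) * a) - b)%Z -> x ^ b != y ^+ a.
Proof.
move=> mu_unit mu1 muN1 x0 ntx a0.
have [[b0 Db0] | no_b] := pselect (exists b0 : int, x ^ b0 = y ^+ a).
  have [N0 [N00 N0P]] := Zhat_irrational_modulus b0 mu_unit mu1 muN1 a0.
  exists N0; split=> // N /N0P Nb0 b Nb; apply: contraNneq Nb0 => Db.
  by have <- : b = b0 by apply: (nontorsion_expz_inj x0 ntx); rewrite /= Db Db0.
exists 1%N; split=> // N _ b _; apply/eqP => Db; apply: no_b.
by exists b.
Qed.

(** Box principle: the residues of [k * m] modulo [T * q], for [0 <= k <= T], fall into [T]
    intervals of length [q]. *)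
Lemma dirichlet (T q m : nat) : (0 < T)%N -> (0 < q)%N ->
  exists a (b : int), [/\ (0 < a)%N, (a <= T)%N, (`|b| <= q)%N
    & ((T * q)%N %| Posz (m * a) - b)%Z].
Proof.
move=> T0 q0; set n := (T * q)%N.
have n0 : (0 < n)%N by rewrite muln_gt0 T0.
have lt_T k : (k * m %% n %/ q < T)%N by rewrite ltn_divLR // ltn_pmod.
have [i [j [/andP[ij jT] Eij]]] := pigeonhole (fun k => Ordinal (lt_T k)).
rewrite card_ord in jT; case: Eij => Eij.
exists (j - i)%N, (Posz (j * m %% n) - Posz (i * m %% n)); split.
- by rewrite subn_gt0.
- exact: leq_trans (leq_subr _ _) jT.
- have /= := divn_eq (i * m %% n) q; have := divn_eq (j * m %% n) q.
  rewrite Eij; have := ltn_pmod (i * m %% n) q0; have := ltn_pmod (j * m %% n) q0.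
  move: (_ %% q)%N (_ %% q)%N (_ * q)%N => r1 r2 t lt1 lt2 -> ->.
  by move: lt1 lt2; lia.
have -> : Posz (m * (j - i)) - (Posz (j * m %% n) - Posz (i * m %% n))
    = (Posz (j * m %/ n) - Posz (i * m %/ n)) * Posz n.
  have Di := divn_eq (i * m) n; have Dj := divn_eq (j * m) n.
  have Dm : (m * (j - i) + i * m = j * m)%N by rewrite mulnC -mulnDl subnK // ltnW.
  move: Di Dj Dm; move: (_ %/ _)%N (_ %/ _)%N (_ %% _)%N (_ %% _)%N => q1 q2 r1 r2.
  move: (i * m)%N (j * m)%N (m * _)%N => u v w -> -> E.
  have : Posz (w + (q2 * n + r2)) = Posz (q1 * n + r1) by rewrite E.
  rewrite !PoszD !PoszM => E'.
  by rewrite mulrBl; lia.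
by rewrite dvdz_mull.
Qed.

Lemma wmul_prod_congr (S : subringClosed algC) w (s : seq algC) (F G : algC -> algC) :
  (forall y, y \in s -> [/\ F y \in S, G y \in S & F y - G y \in wmul S w]) ->
  \prod_(y <- s) F y - \prod_(y <- s) G y \in wmul S w.
Proof.
elim: s => [|y s IHs] FG; first by rewrite !big_nil subrr rpred0.
rewrite !big_cons; have [Fy Gy FGy] := FG y (mem_head _ _).
have IH := IHs (fun z zs => FG z (@mem_behead _ (y :: s) z zs)).
set P := \prod_(_ <- s) _ in IH *; set Q := \prod_(_ <- s) _ in IH *.
have QS : Q \in S.
  rewrite /Q big_seq; apply: rpred_prod => z zs.
  by have [] := FG z (@mem_behead _ (y :: s) z zs).
have -> : F y * P - G y * Q = F y * (P - Q) + Q * (F y - G y) by ring.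
by rewrite rpredD ?wmulM.
Qed.

(* [x ^+ m - y] divides [x ^+ (m * a) - y ^+ a], which is congruent to
   [x ^ b - y ^+ a]. *)
Lemma prod_relation_dvd (S : subringClosed algC) (x l : algC) (ss : seq algC)
    (N m a : nat) (b : int) :
  x != 0 -> x \in S -> x^-1 \in S -> l != 0 -> l^-1 \in S ->
  (forall y, y \in ss -> y \in S) ->
  l * \prod_(y <- ss) (x ^+ m - y) \in wmul S (x ^+ N.+2 - 1) ->
  (N.+2 %| Posz (m * a) - b)%Z ->
  \prod_(y <- ss) (x ^ b - y ^+ a) \in wmul S (x ^+ N.+2 - 1).
Proof.
move=> x0 xS xVS l0 lVS ssS lprod mab.
have bS : x ^ b \in S by case: (b) => k; rewrite ?NegzE -?exprnN -?exprVn rpredX.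
have pI := wmulM lVS lprod; rewrite mulKf // in pI.
have paI : \prod_(y <- ss) (x ^+ (m * a) - y ^+ a) \in wmul S (x ^+ N.+2 - 1).
  have -> : \prod_(y <- ss) (x ^+ (m * a) - y ^+ a)
      = (\prod_(y <- ss) \sum_(i < a) (x ^+ m) ^+ (a.-1 - i) * y ^+ i)
        * \prod_(y <- ss) (x ^+ m - y).
    by rewrite -big_split; apply: eq_bigr => y _ /=; rewrite [RHS]mulrC exprM subrXX.
  apply: wmulM pI; rewrite big_seq; apply: rpred_prod => y /ssS yS.
  by apply: rpred_sum => i _; rewrite rpredM ?rpredX.
rewrite -[X in X \in _](subrK (\prod_(y <- ss) (x ^+ (m * a) - y ^+ a))) rpredD //.
apply: wmul_prod_congr => y /ssS yS; split.
- by rewrite rpredB ?rpredX.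
- by rewrite rpredB ?rpredX.
have -> : x ^ b - y ^+ a - (x ^+ (m * a) - y ^+ a) = - (x ^+ (m * a) - x ^ b) by ring.
by rewrite rpredN; apply: (@expz_congr _ _ _ _ xS xVS (Posz (m * a))).
Qed.

(** * The minimal polynomial of a root *)

Lemma laurent_poly (f : laurent) : f != 0 ->
  exists s (fp : {poly int}), fp != 0 /\
    forall x : algC, x != 0 -> (pZtoC fp).[x] = x ^+ s * laurent_horner f x.
Proof.
(* The sum bounds every [|k|] in the support, so [X^s f] has no negative exponents. *)
move=> f0; pose s := (\sum_(k <- msupp f) `|k|)%N.
have sk k : k \in msupp f -> 0 <= Posz s + k.
  move=> kf; have : (`|k| <= s)%N by rewrite /s (big_rem k) //= leq_addr.
  by lia.
pose fp : {poly int} := \sum_(k <- msupp f) f@_k *: 'X^(absz (Posz s + k)%R).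
exists s, fp; split.
  have [k0 k0f] : exists k0, k0 \in msupp f.
    apply: contrapT => /forallNP supp0; case/eqP: f0; apply/malgP => k.
    by rewrite mcoeff0 mcoeff_outdom //; apply/negP/supp0.
  apply: contraTneq k0f => /(congr1 (fun p : {poly int} => p`_(absz (Posz s + k0)%R))).
  rewrite coef0 coef_sum; have [k0f | //] := boolP (k0 \in msupp f).
  rewrite (big_rem k0) //= coefZ coefXn eqxx mulr1 big_seq big1 ?addr0.
    by move/eqP; rewrite -mcoeff_neq0 in k0f; rewrite (negPf k0f).
  move=> k; rewrite mem_rem_uniq ?fset_uniq // inE => /andP[kk0 kf].
  rewrite coefZ coefXn; case: eqP => [E|_]; last by rewrite mulr0.
  case/eqP: kk0; have := sk k kf; have := sk k0 k0f; move: E; lia.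
move=> x x0; rewrite rmorph_sum horner_sum /laurent_horner mulr_sumr.
rewrite [LHS]big_seq [RHS]big_seq; apply: eq_bigr => k kf.
rewrite /= map_polyZ hornerZ map_polyXn hornerXn mulrCA; congr (_ * _).
by rewrite -[x ^+ s]/(x ^ Posz s) -expfzDr // exprnP gez0_abs ?sk.
Qed.

(** Here [g] is the minimal polynomial rescaled to be primitive, hence nonzero modulo every prime.
    By the last clause, facts stated through integer polynomials pass from [a] to its conjugates. *)
Lemma min_int_poly (a : algC) : exists (g : {poly int}) rs,
  [/\ g != 0, forall p, prime p -> map_poly (intr : int -> 'F_p) g != 0,
      roots_of g rs, a \in rs &
      forall x (q : {poly int}), x \in rs ->
        root (pZtoC q) x = root (pZtoC q) a].
Proof.
have [p [Dp mon_p] min_p] := minCpolyP a.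
have [q0 [l l0 Dq0]] := rat_poly_scale p.
have q00 : q0 != 0.
  by apply: contraTneq (monic_neq0 mon_p) => q00; rewrite Dq0 q00 rmorph0 scaler0 eqxx.
pose g := zprimitive q0; have g0 : g != 0 by rewrite zprimitive_eq0.
have [rs Dg] := roots_of_exists g.
pose toQ := map_poly (intr : int -> rat); pose ratC := map_poly (ratr : rat -> algC).
have QC (q : {poly int}) : ratC (toQ q) = pZtoC q.
  by rewrite /ratC /toQ -map_poly_comp; apply: eq_map_poly => b; rewrite /= ratr_int.
have rootg x : root (pZtoC g) x = root (ratC p) x.
  rewrite Dq0 /ratC map_polyZ rootZ ?fmorph_eq0 ?invr_eq0 ?intr_eq0 //.
  have -> : map_poly ratr (map_poly intr q0) = pZtoC q0 := QC q0.
  rewrite [q0 in RHS]zpolyEprim map_polyZ rootZ //.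
  by rewrite intr_eq0 zcontents_eq0.
exists g, rs; split=> //.
- move=> r pr; apply/eqP => gr0.
  have : (r %| zcontents g)%Z.
    rewrite dvdz_contents; apply/polyOverP => i.
    rewrite -[_ \in _]/((r %| g`_i)%Z) -intr_Fp_eq0 //.
    have := congr1 (fun h : {poly 'F_r} => h`_i) gr0.
    by rewrite coef_map coef0 /= => ->.
  rewrite zcontents_primitive q00 dvdzE /= dvdn1 => /eqP r1.
  by rewrite r1 in pr.
- by rewrite -(root_roots_of _ g0 Dg) rootg min_p.
move=> x q; rewrite -(root_roots_of _ g0 Dg) rootg => px.
have [p' [Dp' mon_p'] min_p'] := minCpolyP x.
have p'p : p' %| p by rewrite -min_p'.
(* Irreducibility of [p]: in [p = e * p'], the factor [e] has too small a degree to be divisible by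
   [p]. *)
have pp' : p %| p'.
  have [e De] := dvdpP _ _ p'p.
  have /orP[pe | //] : (p %| e) || (p %| p').
    by rewrite -!min_p -rootM -rmorphM -De min_p.
  have : e * p' != 0 by rewrite -De monic_neq0.
  rewrite mulf_eq0 negb_or => /andP[e0 _].
  have := dvdp_leq e0 pe; rewrite {1}De size_mul // ?(monic_neq0 mon_p') //.
  have : (1 < size p')%N.
    by rewrite -(size_map_poly (ratr : rat -> algC)) -Dp' size_minCpoly.
  have : (0 < size e)%N by rewrite size_poly_gt0.
  by move: (size _) (size _) => m n; lia.
rewrite -QC min_p min_p'.
by apply/idP/idP; apply: dvdp_trans.
Qed.

Lemma clear_denominator (y : algC) : exists l, (0 < l)%N /\ l%:R * y \in Aint.
Proof.
have [g [rs [g0 _ Dg yrs _]]] := min_int_poly y.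
exists `|lead_coef g|%N; split; first by rewrite absz_gt0 lead_coef_eq0.
have : (lead_coef g)%:~R * y \in Aint.
  by apply: Aint_lead_root; rewrite (root_roots_of _ g0 Dg).
by case: (lead_coef g) => k; rewrite ?NegzE ?rmorphN /= ?mulNr ?rpredN -pmulrn.
Qed.

Lemma upper_bound (s : seq algC) :
  exists B, (0 < B)%N /\ forall x, x \in s -> `|x| <= B%:R.
Proof.
elim: s => [|x s [B [B0 BP]]]; first by exists 1%N.
exists (Num.bound `|x| + B)%N; split=> [|y]; first by rewrite addn_gt0 B0 orbT.
rewrite natrD inE => /predU1P[-> | /BP le].
  by rewrite ler_wpDr ?ler0n // ltW // archi_boundP.
by rewrite ler_wpDl ?ler0n.
Qed.

(** * Comparison of the two estimates *)

Lemma Aint_relation (c : nat) (x y : algC) a (b : int) :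
  c%:R * x \in Aint -> c%:R * x^-1 \in Aint -> c%:R * y \in Aint ->
  c%:R ^+ (a + `|b|) * (x ^ b - y ^+ a) \in Aint.
Proof.
move=> cx cxV cy; have cA k : c%:R ^+ k \in Aint by rewrite rpredX // rpred_nat.
have cxb : c%:R ^+ `|b| * x ^ b \in Aint.
  case: (b) => k; rewrite ?NegzE ?abszN ?absz_nat -?exprnN -?exprnP -?exprVn.
    by rewrite -exprMn rpredX.
  by rewrite -exprMn rpredX.
rewrite mulrBr rpredB // exprD; first by rewrite -mulrA rpredM.
by rewrite mulrAC -exprMn rpredM ?cA ?rpredX.
Qed.

Lemma norm_expz_le (B : nat) (x : algC) (b : int) :
  `|x| <= B%:R -> `|x^-1| <= B%:R -> `|x ^ b| <= B%:R ^+ `|b|.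
Proof.
move=> xB xVB; case: b => k.
  by rewrite -exprnP normrX lerXn2r ?nnegrE ?ler0n.
by rewrite NegzE abszN absz_nat -exprnN -exprVn normrX lerXn2r ?nnegrE ?ler0n.
Qed.

(** With [e = a + |b|], both terms are at most [B^e], and [2 <= 2^e] because [e] is positive. *)
Lemma norm_relation_le (c B : nat) (x y : algC) a (b : int) : (0 < B)%N -> (0 < a)%N ->
  `|x| <= B%:R -> `|x^-1| <= B%:R -> `|y| <= B%:R ->
  `|c%:R ^+ (a + `|b|) * (x ^ b - y ^+ a)| <= (2 * B * c)%N%:R ^+ (a + `|b|).
Proof.
move=> B0 a0 xB xVB yB; set e := (a + _)%N.
have B1 : 1 <= B%:R :> algC by rewrite ler1n.
rewrite normrM normrX normr_nat natrM exprMn mulrC ler_wpM2r ?exprn_ge0 ?ler0n //.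
apply: le_trans (ler_normB _ _) _.
have le1 : `|x ^ b| <= B%:R ^+ e.
  by rewrite (le_trans (norm_expz_le _ xB xVB)) // ler_weXn2l // leq_addl.
have le2 : `|y ^+ a| <= B%:R ^+ e.
  rewrite normrX (@le_trans _ _ (B%:R ^+ a)) ?lerXn2r ?nnegrE ?ler0n //.
  by rewrite ler_weXn2l // leq_addr.
apply: le_trans (lerD le1 le2) _; rewrite natrM exprMn.
have -> : B%:R ^+ e + B%:R ^+ e = 2 * B%:R ^+ e :> algC by rewrite mulr_natl mulr2n.
rewrite ler_wpM2r ?exprn_ge0 ?ler0n // -{1}[2]expr1 ler_weXn2l ?ler1n //.
by rewrite /e addn_gt0 a0.
Qed.

Lemma wmul_prod (S : subringClosed algC) (rs : seq algC) (F w : algC -> algC) :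
  (forall x, x \in rs -> F x \in wmul S (w x)) ->
  \prod_(x <- rs) F x \in wmul S (\prod_(x <- rs) w x).
Proof.
elim: rs => [|x rs IHs] Fw.
  by rewrite !big_nil; apply/wmulP; exists 1; rewrite ?rpred1 ?mulr1.
have /wmulP[v vS Dv] := Fw x (mem_head _ _).
have /wmulP[u uS Du] := IHs (fun z zs => Fw z (@mem_behead _ (x :: rs) z zs)).
apply/wmulP; exists (v * u); first exact: rpredM.
by rewrite !big_cons Dv Du mulrACA.
Qed.

(* The product on the right is an integer which [E] divides up to powers of [c]. *)
Lemma resultant_le (g fp : {poly int}) rs ss (c a : nat) (b E : int)
    (h : algC -> algC) D s :
  g != 0 -> fp != 0 -> roots_of g rs -> roots_of fp ss ->
  (0 < c)%N -> (`|lead_coef g| %| c)%N -> coprime `|E| c ->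
  E%:~R = (-1) ^+ s * (lead_coef g)%:~R ^+ D * \prod_(x <- rs) h x ->
  (forall x, x \in rs -> c%:R * x \in Aint /\ c%:R * x^-1 \in Aint) ->
  (forall y, y \in ss -> c%:R * y \in Aint) ->
  (forall x y, x \in rs -> y \in ss -> x ^ b != y ^+ a) ->
  (forall x, x \in rs -> \prod_(y <- ss) (x ^ b - y ^+ a) \in wmul (Sint c) (h x)) ->
  `|E%:~R| <= \prod_(x <- rs) \prod_(y <- ss) `|c%:R ^+ (a + `|b|) * (x ^ b - y ^+ a)|.
Proof.
move=> g0 fp0 Dg Dfp c0 lc Ec DE cx cy rel0 dvd_h.
set l : algC := (lead_coef g)%:~R in DE *.
have l0 : l != 0 by rewrite intr_eq0 lead_coef_eq0.
pose F x y : algC := c%:R ^+ (a + `|b|) * (x ^ b - y ^+ a).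
pose W := \prod_(x <- rs) \prod_(y <- ss) F x y.
have F_Aint x y : x \in rs -> y \in ss -> F x y \in Aint.
  by move=> /cx[cx1 cx2] /cy cy1; apply: Aint_relation.
(* Rational by Galois invariance, and an algebraic integer since the powers of [c] clear all
   denominators. *)
have W_int : W \in Num.int.
  apply: Cint_rat_Aint.
    apply: Crat_prod_roots g0 fp0 Dg Dfp _ => nu x y.
    by rewrite rmorphM rmorphXn rmorph_nat rmorphB fmorphXz rmorphXn.
  rewrite /W big_seq; apply: rpred_prod => x xrs.
  by rewrite big_seq; apply: rpred_prod => y yss; apply: F_Aint.
have W0 : W != 0.
  rewrite prodf_seq_neq0; apply/allP => x xrs /=.
  rewrite prodf_seq_neq0; apply/allP => y yss /=.
  by rewrite mulf_neq0 ?expf_neq0 ?pnatr_eq0 -?lt0n // subr_eq0 rel0.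
have [V VS DV] : exists2 V, V \in Sint c & W = \prod_(x <- rs) h x * V.
  apply/wmulP/wmul_prod => x xrs; rewrite big_split /=.
  apply: wmulM (dvd_h x xrs); rewrite big_const_seq iter_mulr_1.
  by rewrite !rpredX // rpred_nat.
have EV : E%:~R * V = (-1) ^+ s * l ^+ D * W by rewrite DE DV mulrA.
have E0 : E%:~R != 0 :> algC.
  apply: contraNneq W0 => E0; move/eqP: EV; rewrite E0 mul0r eq_sym.
  by rewrite !mulf_eq0 !expf_eq0 (negPf l0) oppr_eq0 oner_eq0 !andbF.
(* The cofactor is [W] times a rational number, so a power of [c] turns it into an integer [z]. *)
have VQ : V \in Crat.
  rewrite -(mulKf E0 V) EV; apply: rpredM; first by rewrite rpredV; apply: rpred_int.
  rewrite !rpredM ?rpredX ?rpredN ?rpred1 ?rpred_int //.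
  by case/intrP: W_int => z ->; apply: rpred_int.
have [J [z Dz]] := Sint_Crat VS VQ.
have [W' DW'] := intrP W_int.
have : E * z = Posz c ^+ J * ((-1) ^+ s * lead_coef g ^+ D * W').
  apply: (@intr_inj algC); rewrite !rmorphM !rmorphXn /= rmorphN rmorph1 -DW' -Dz.
  by rewrite mulrCA EV -/l pmulrn.
move/(congr1 absz); rewrite !abszM !abszX absz_nat abszN absz1 exp1n mul1n => DEz.
(* As [E] is prime to [c], the powers of [c] and of the leading coefficient can be cancelled. *)
have /(Gauss_dvdr `|W'|%N) ELW : coprime `|E| (c ^ J * `|lead_coef g| ^ D)%N.
  by rewrite coprimeMr !coprimeXr // (coprime_dvdr lc).
have : (`|E| %| `|W'|)%N by rewrite -ELW -mulnA -DEz dvdn_mulr.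
move/dvdn_leq; rewrite absz_gt0.
have -> : W' != 0 by apply: contraNneq W0 => W'0; rewrite DW' W'0.
move=> /(_ isT) le_EW; apply: le_trans (_ : `|W| <= _); last first.
  by rewrite /W norm_prod_seq; under eq_bigr do rewrite norm_prod_seq.
by rewrite DW' -!intr_norm ler_int -!abszE lez_nat.
Qed.

Lemma wmul_dvd (S : subringClosed algC) (u w x : algC) :
  u \in S -> x \in wmul S (u * w) -> x \in wmul S w.
Proof.
move=> uS /wmulP[v vS ->]; rewrite -mulrA mulrCA; apply/wmulP.
by exists (u * v); rewrite ?rpredM.
Qed.

Lemma Aint_absz_div (l : int) : l != 0 -> `|l|%N%:R / l%:~R \in Aint.
Proof.
case: l => k l0; first by rewrite -pmulrn divff ?Aint1 // pnatr_eq0.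
rewrite NegzE abszN absz_nat rmorphN /= -pmulrn invrN mulrN divff ?pnatr_eq0 //.
by rewrite rpredN Aint1.
Qed.

(* With [N0 * k = T * q], the factor [C1 ^+ q] occurs on both sides; what remains
   bounds [2 ^+ q] independently of [k]. *)
Lemma resultant_growth (rs : seq algC) (l E delta : algC) (N0 k T q C1 : nat)
    (h : algC -> algC) :
  (0 < C1)%N -> 0 < delta -> (N0 * k = T * q)%N -> (0 < k)%N ->
  `|E| = `|l| ^+ (N0 * k.-1) * \prod_(x <- rs) `|h x| ->
  (forall x, x \in rs -> x ^+ (N0 * k) - 1 = (x ^+ N0 - 1) * h x) ->
  (forall x, x \in rs -> delta * max1 x ^+ (N0 * k) <= `|x ^+ (N0 * k) - 1|) ->
  (2 * C1)%N%:R <= (`|l| * \prod_(x <- rs) max1 x) ^+ T ->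
  `|E| <= C1%:R ^+ (T + q) ->
  2%:R ^+ q * delta ^+ size rs
    <= C1%:R ^+ T * (`|l| ^+ N0 * \prod_(x <- rs) `|x ^+ N0 - 1|).
Proof.
move=> C10 d0 Dq k0 DE Dh wind leM leE; set Q := `|l| ^+ N0 * _.
have C1q : 0 < C1%:R ^+ q :> algC by rewrite exprn_gt0 ?ltr0n.
rewrite -(ler_pM2l C1q).
(* Multiplying by [Q] restores the factors [x ^+ N0 - 1] left out of [h]. *)
have EQ : `|E| * Q = `|l| ^+ (N0 * k) * \prod_(x <- rs) `|x ^+ (N0 * k) - 1|.
  rewrite DE /Q mulrACA -exprD -big_split /= -mulnSr prednK //; congr (_ * _).
  by rewrite !big_seq; apply: eq_bigr => x xrs; rewrite Dh // normrM mulrC.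
have Q0 : 0 <= Q.
  by rewrite mulr_ge0 ?exprn_ge0 ?normr_ge0 // -norm_prod_seq normr_ge0.
apply: le_trans (_ : `|E| * Q <= _); last first.
  by rewrite [leRHS]mulrA -exprD addnC ler_wpM2r.
rewrite EQ.
have /andP[_ low] : 0 <= \prod_(x <- rs) (delta * max1 x ^+ (N0 * k))
    <= \prod_(x <- rs) `|x ^+ (N0 * k) - 1|.
  apply: ler_prod_seq => x xrs; rewrite wind // andbT mulr_ge0 ?ltW // exprn_gt0 //.
  exact: lt_le_trans ltr01 (max1_ge1 x).
apply: le_trans (ler_wpM2l (exprn_ge0 _ (normr_ge0 l)) low).
rewrite big_split /= big_const_seq count_predT iter_mulr_1.
rewrite prodrXl [leRHS]mulrCA -[in leRHS]exprMn.
have -> : C1%:R ^+ q * (2%:R ^+ q * delta ^+ size rs)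
    = delta ^+ size rs * (2 * C1)%N%:R ^+ q.
  by rewrite natrM exprMn [RHS]mulrC mulrCA mulrA.
rewrite ler_wpM2l ?exprn_ge0 ?(ltW d0) // Dq exprM.
by rewrite lerXn2r ?nnegrE ?ler0n // (le_trans _ leM) ?ler0n.
Qed.

(** * Choice of the constants and the contradiction *)

Theorem theorem1p4 (f : laurent) (mu : Zhat)
  (f_neq0 : f != 0) (mu_unit : mu \is a GRing.unit)
  (eq_ideals : principal_ideal (laurent_tpow f 1)
             = principal_ideal (laurent_tpow f mu)) :
  (mu = 1 \/ mu = -1)
  \/ (forall a : algC, laurent_root f a -> exists2 n, (0 < n)%N & n.-unity_root a).
Proof.
have [mu1 | mu1] := pselect (mu = 1); first by left; left.
have [muN1 | muN1] := pselect (mu = -1); first by left; right.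
right=> al [al0 fal]; apply: contrapT => ntors.
have nta : nontorsion al.
  move=> n n0; apply/eqP => aln; apply: ntors; exists n => //.
  exact/unity_rootP.
have [g [rs [g0 g_prim Dg al_rs same]]] := min_int_poly al.
have [s [fp [fp0 fpE]]] := laurent_poly f_neq0.
have [ss Dss] := roots_of_exists fp.
(* The clause [same], applied to ['X], to ['X^n - 1] and to [fp], transports the properties of [al]
   to all roots of [g]. *)
have rs0 x : x \in rs -> x != 0.
  move=> xrs; have := same x 'X xrs.
  by rewrite map_polyX !rootX (negPf al0) => ->.
have rs_nt x : x \in rs -> nontorsion x.
  move=> xrs n n0; have := same x ('X^n - 1) xrs.
  rewrite rmorphB /= map_polyXn rmorph1 /root !hornerD !hornerN !hornerXn !hornerC.
  by rewrite !subr_eq0 (negPf (nta n n0)) => ->.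
have rs_f x : x \in rs -> laurent_horner f x = 0.
  move=> xrs; have : root (pZtoC fp) x.
    by rewrite (same x fp xrs) /root fpE // fal mulr0.
  by rewrite /root fpE ?rs0 // mulf_eq0 expf_eq0 (negPf (rs0 x xrs)) andbF => /eqP.
pose pts := rs ++ [seq x^-1 | x <- rs] ++ ss.
have rs_pts x : x \in rs -> x \in pts /\ x^-1 \in pts.
  by move=> xrs; rewrite !mem_cat xrs map_f // orbT.
have ss_pts y : y \in ss -> y \in pts by rewrite !mem_cat => ->; rewrite !orbT.
have [c1 [c10 c1P]] : exists N, (0 < N)%N /\ forall y n, y \in pts -> (N %| n)%N ->
    n%:R * y \in Aint.
  apply: common_modulus => y _; have [m [m0 my]] := clear_denominator y.
  exists m; split=> // n /dvdnP[q ->].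
  by rewrite natrM -mulrA rpredM // rpred_nat.
(* [c] clears the denominators of all of [pts], and the two leading coefficients become invertible
   in [Sint c]. *)
pose c := (c1 * (`|lead_coef g| * `|lead_coef fp|))%N.
have c0 : (0 < c)%N by rewrite !muln_gt0 c10 !absz_gt0 !lead_coef_eq0 g0 fp0.
have cx x : x \in rs -> c%:R * x \in Aint /\ c%:R * x^-1 \in Aint.
  by move=> /rs_pts[p1 p2]; split; apply: c1P => //; apply: dvdn_mulr.
have cy y : y \in ss -> c%:R * y \in Aint.
  by move=> /ss_pts p1; apply: c1P => //; apply: dvdn_mulr.
have lc : (`|lead_coef g| %| c)%N by rewrite dvdn_mull // dvdn_mulr.
have lfp0 : (lead_coef fp)%:~R != 0 :> algC by rewrite intr_eq0 lead_coef_eq0.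
have lfpV : (lead_coef fp)%:~R^-1 \in Sint c.
  apply: Sint_scale; rewrite /c mulnA natrM -mulrA rpredM ?rpred_nat //.
  by rewrite Aint_absz_div // lead_coef_eq0.
have [B [B0 BP]] := upper_bound pts.
(* [C0] bounds one factor of the double product per unit of the exponent [a + |b|]; [C1] bounds all
   of them together. *)
pose C0 := (2 * B * c)%N; pose C1 := (C0 ^ (size rs * size ss))%N.
have C00 : (0 < C0)%N by rewrite /C0 muln_gt0 c0 andbT muln_gt0 B0.
have C10 : (0 < C1)%N by rewrite expn_gt0 C00.
have M1 : 1 < `|(lead_coef g)%:~R| * \prod_(x <- rs) max1 x.
  apply: kronecker Dg _ _ _ => //.
    by apply: contraTneq al_rs => ->.
  by apply/negP => /rs0; rewrite eqxx.
have [T [T0 TP]] := exp_unbounded (2 * C1) M1.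
have [N1 [N10 N1P]] := geom_resultant c0 Dg g_prim.
(* Since [a <= T], only finitely many triples [(x, y, a)] occur, and one modulus excludes all their
   relations. *)
have [N2 [N20 N2P]] : exists N, (0 < N)%N /\ forall (w : algC * algC * nat) n,
    w \in [seq (xy, a) | xy <- [seq (x, y) | x <- rs, y <- ss], a <- iota 1 T] ->
    (N %| n)%N -> forall N', n = N'.+2 -> forall b : int,
    (N'.+2 %| Posz (val (mu N' : 'Z_N'.+2) * w.2) - b)%Z -> w.1.1 ^ b != w.1.2 ^+ w.2.
  apply: common_modulus => w /allpairsP[[xy a] /= [+ a_in ->]].
  case/allpairsP=> [[x y] /= [xrs _ ->]].
  have /= /andP[a0 _] : (1 <= a < 1 + T)%N by rewrite -mem_iota.
  have [N [N0 NP]] := avoid_relation y mu_unit mu1 muN1 (rs0 _ xrs) (rs_nt _ xrs) a0.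
  by exists N; split=> // n Nn N' Dn b; apply: NP; rewrite -Dn.
pose N0 := (N1 * N2 * (T * 2))%N.
have N00 : (0 < N0)%N by rewrite !muln_gt0 N10 N20 T0.
have Nc0 : (0 < N0 * c)%N by rewrite muln_gt0 N00.
(* The exponents [N0 + N0 * c * j] are [N0 * k] with [k = 1 + c * j], which is coprime to [c]. *)
have [delta [delta0 wind]] := window N0 Nc0 rs_nt.
pose Q := `|(lead_coef g)%:~R : algC| ^+ N0 * \prod_(x <- rs) `|x ^+ N0 - 1|.
(* The bound that [2 ^+ q] will have to obey is known before [j], so [j] can be taken beyond it. *)
pose m := Num.bound (C1%:R ^+ T * Q / delta ^+ size rs).
have [j [mj jP]] := wind m.+1.
pose k := (1 + c * j)%N; pose q := (N1 * N2 * 2 * k)%N.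
have Dn : (N0 + N0 * c * j = N0 * k)%N by rewrite /k mulnDr muln1 mulnA.
rewrite Dn in jP.
have Dq : (N0 * k = T * q)%N by rewrite /N0 /q; ring.
have j0 : (0 < j)%N by apply: leq_trans mj.
have k1 : (1 < k)%N by rewrite /k add1n ltnS muln_gt0 c0.
have kc : coprime k c by rewrite /k coprime_sym /coprime addnC (mulnC c) gcdnMDl gcdn1.
have N1N0 : (N1 %| N0)%N by rewrite /N0 -!mulnA dvdn_mulr.
have [E [sg [Ec DE]]] := N1P N0 k N1N0 N00 k1 kc.
have q0 : (0 < q)%N by rewrite !muln_gt0 N10 N20 (ltnW k1).
have jq : (j < q)%N.
  apply: (@leq_trans k); first by rewrite /k add1n ltnS leq_pmull.
  by rewrite /q leq_pmull // !muln_gt0 N10 N20.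
have [N DN] : exists N, (N0 * k = N.+2)%N.
  have := leq_trans k1 (leq_pmull k N00).
  by case: (N0 * k)%N => [|[|N]] // _; exists N.
have [a [b [a0 aT bq ab]]] := dirichlet (val (mu N : 'Z_N.+2)) T0 q0.
rewrite -Dq DN in ab.
have rel0 x y : x \in rs -> y \in ss -> x ^ b != y ^+ a.
  move=> xrs yss; apply: (N2P (x, y, a) (N0 * k)%N _ _ N DN b ab).
    apply/allpairsP; exists ((x, y), a).
    by rewrite /= mem_iota a0 add1n ltnS aT allpairs_f.
  by rewrite /N0 -!mulnA dvdn_mull // dvdn_mulr.
have Dh x : x ^+ (N0 * k) - 1 = (x ^+ N0 - 1) * (geom algC N0 k).[x].
  have := congr1 (fun p : {poly algC} => p.[x]) (geomE algC N0 k).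
  by rewrite hornerM !hornerD !hornerN !hornerXn !hornerC.
have dvd_h x : x \in rs ->
    \prod_(y <- ss) (x ^ b - y ^+ a) \in wmul (Sint c) (geom algC N0 k).[x].
  move=> xrs; have [cx1 cx2] := cx x xrs.
  have xS := Sint_scale cx1; have xVS := Sint_scale cx2.
  (* It suffices to divide by all of [x ^+ (N0 * k) - 1], of which the value of [geom] is a
     factor. *)
  apply: (@wmul_dvd _ (x ^+ N0 - 1)); first by rewrite rpredB ?rpredX ?rpred1.
  rewrite -Dh DN; apply: (@prod_relation_dvd _ _ (lead_coef fp)%:~R _ _
    (val (mu N : 'Z_N.+2)) _ _ (rs0 x xrs) xS xVS lfp0 lfpV _ _ ab).
    by move=> y /cy; apply: Sint_scale.
  set w := x ^+ N.+2 - 1.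
  have w0 : w != 0 by rewrite subr_eq0 rs_nt.
  (* The evaluation needs a coefficient modulus lying in the ideal of [w]: [2 * M] is [w] times an
     algebraic integer, and the factor 2 makes it at least 2. *)
  have [M [M0 MP]] := clear_denominator w^-1.
  have MI : (2 * M).-2.+2%:R \in wmul (Sint c) w.
    have -> : (2 * M).-2.+2 = (2 * M)%N.
      by move: M0; case: (M) => // M' _; rewrite mulnS.
    apply/wmulP; exists ((2 * M)%N%:R * w^-1); last by rewrite mulrCA mulfV // mulr1.
    apply: Sint_scale; rewrite natrM -[_ * w^-1]mulrA.
    by apply: rpredM; [exact: rpred_nat | apply: rpredM; [exact: rpred_nat |]].
  have horner_I := laurent_horner_tpow (rs0 x xrs) xS xVS MI eq_ideals (rs_f x xrs).
  have -> : (lead_coef fp)%:~R * \prod_(y <- ss) (x ^+ val (mu N : 'Z_N.+2) - y)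
      = (pZtoC fp).[x ^+ val (mu N : 'Z_N.+2)].
    rewrite Dss hornerZ horner_prod; congr (_ * _).
    by apply: eq_bigr => y _; rewrite hornerD hornerN hornerX hornerC.
  by rewrite fpE ?expf_neq0 ?rs0 // wmulM // !rpredX.
have leE := resultant_le g0 fp0 Dg Dss c0 lc Ec DE cx cy rel0 dvd_h.
have e_le : (a + `|b| <= T + q)%N by rewrite leq_add.
have {}leE : `|E%:~R : algC| <= C1%:R ^+ (T + q).
  apply: le_trans leE _.
  apply: le_trans (_ : \prod_(x <- rs) \prod_(y <- ss) (C0%:R ^+ (a + `|b|)) <= _).
    have inner x : x \in rs ->
      0 <= \prod_(y <- ss) `|c%:R ^+ (a + `|b|) * (x ^ b - y ^+ a)|
        <= \prod_(y <- ss) (C0%:R ^+ (a + `|b|) : algC).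
      move=> /rs_pts[/BP xB /BP xVB]; apply: ler_prod_seq => y /ss_pts/BP yB.
      by rewrite normr_ge0 norm_relation_le.
    by have /andP[_] := ler_prod_seq inner.
  rewrite !big_const_seq !count_predT !iter_mulr_1 /C1 natrX -!exprM.
  rewrite ler_weXn2l ?ler1n //.
  by rewrite mulnC [(size ss * _)%N]mulnC leq_mul2l e_le orbT.
have normE : `|E%:~R : algC| = `|(lead_coef g)%:~R| ^+ (N0 * k.-1)
    * \prod_(x <- rs) `|(geom algC N0 k).[x]|.
  by rewrite DE !normrM !normrX normrN1 expr1n mul1r norm_prod_seq.
have := resultant_growth C10 delta0 Dq (ltnW k1) normE (fun x _ => Dh x) jP TP leE.
rewrite -/Q -ler_pdivlMr ?exprn_gt0 // => le2q.
have R0 : 0 <= C1%:R ^+ T * Q / delta ^+ size rs.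
  exact: le_trans (exprn_ge0 _ (ler0n _ _)) le2q.
(* The estimates give [2 ^ q < m], against [m < j < q < 2 ^ q]. *)
have := le_lt_trans le2q (archi_boundP R0); rewrite -/m -natrX ltr_nat.
rewrite ltnNge (leq_trans _ (ltnW (ltn_expl q (ltnSn 1)))) //.
by rewrite ltnW // (leq_trans mj) // ltnW.
Qed.
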